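(* Let $V$ be a Banach space whose algebraic tensor powers carry norms as described in the context, let $p\ge1$ and $T>0$. Let $(x(n))_{n=0}^\infty$ be a sequence in $WG\Omega_p(V)$ such that $\sup_n\|x(n)\|_{p\text{-}var}<\infty$ and $(x(n))_{n=0}^\infty$ converges uniformly on $[0,T]$ to $x\in WG\Omega_p(V)$. Then $(x(n))_{n=0}^\infty$ has a subsequence $(x(n_k))_{k=0}^\infty$ such that $S(x(n_k))\to S(x)$ as $k\to\infty$, i.e. $d(S(x(n_k)),S(x))\to0$.
   Context: $V$ is a Banach space; $V^{\otimes_a k}$ is the $k$-fold algebraic tensor power ($V^{\otimes_a 0}=\mathbb{R}$, $V^{\otimes_a 1}=V$ with its own norm). Each $V^{\otimes_a k}$ carries a norm $\|\cdot\|_{V^{\otimes_a k}}$ such that: (1) $\|a\otimes b\|_{V^{\otimes_a(m+n)}}\le \|a\|_{V^{\otimes_a m}}\|b\|_{V^{\otimes_a n}}$ for $a\in V^{\otimes_a m}$, $b\in V^{\otimes_a n}$; (2) for every permutation $\sigma$ of $\{1,\dots,n\}$, the linear map on $V^{\otimes_a n}$ determined by $v_1\otimes\cdots\otimes v_n\mapsto v_{\sigma(1)}\otimes\cdots\otimes v_{\sigma(n)}$ preserves $\|\cdot\|_{V^{\otimes_a n}}$. $V^{\otimes k}$ denotes the completion of $V^{\otimes_a k}$; multiplication $\otimes$ extends to $V^{\otimes m}\times V^{\otimes n}\to V^{\otimes (m+n)}$. $\tilde{T}^{(n)}(V)=1\oplus V\oplus\cdots\oplus V^{\otimes n}$ is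 the set of truncated tensor series $a=(a_0,\dots,a_n)$ with $a_0=1$, $a_k\in V^{\otimes k}$, a group under truncated multiplication $(a\otimes b)_k=\sum_{i=0}^k a_i\otimes b_{k-i}$, with identity $\mathbf{1}=(1,0,\dots,0)$; $\tilde{T}((V))$ is the analogous group of infinite series $(a_j)_{j\ge0}$ with $a_0=1$. $\pi^{(n)}$ and $\pi_n$ are the projections onto $\tilde{T}^{(n)}(V)$ and $V^{\otimes n}$. Define $\|g\|_{\tilde{T}^{(n)}(V)}=\max_{1\le k\le n}\|\pi_k(g)\|_{V^{\otimes k}}^{1/k}$. Let $[x,y]=x\otimes y-y\otimes x$, $L_a^1(V)=V$, $L_a^{k+1}(V)=\mathrm{Span}\{[x,y]:x\in L_a^k(V),\,y\in V\}$, $\mathcal{L}_a^n(V)=\bigoplus_{i=1}^n L_a^i(V)$, $\exp(l)=\sum_{j=0}^n l^{\otimes j}/j!$ truncated to degrees at most $n$, and let $G^{(n)}$ be the closure of $\exp\mathcal{L}_a^n(V)$ in $\tilde{T}^{(n)}(V)$ (componentwise norm convergence). For a path $x:[0,T]\to\tilde{T}^{(n)}(V)$ let $\|x\|_{p\text{-}var}=\sup_{\mathcal{P}}\big(\sum_{t_j\in\mathcal{P}}\|x_{t_j}^{-1}x_{t_{j+1}}\|_{\tilde{T}^{(n)}(V)}^p\big)^{1/p}$, the supremum being over finite partitions $\mathcal{P}$ of $[0,T]$; $x$ has finite $p$-variation if this is finite. A $p$-weakly geometric rough path over $V$ is a continuous path $x:[0,T]\to\tilde{T}^{(\lfloor p\rfloor)}(V)$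 with $x_t\in G^{(\lfloor p\rfloor)}$ for all $t$ and finite $p$-variation; $WG\Omega_p(V)$ is the set of these. Uniform convergence $x(n)\to x$ means $\sup_{t\in[0,T]}\max_{1\le k\le\lfloor p\rfloor}\|\pi_k(x(n)_t-x_t)\|_{V^{\otimes k}}^{1/k}\to0$. Signature (Lyons): for $x\in WG\Omega_p(V)$ and $n\ge\lfloor p\rfloor$ there is a unique continuous path $S_n(x)_{0,\cdot}:[0,T]\to\tilde{T}^{(n)}(V)$ of finite $p$-variation with $S_n(x)_{0,0}=\mathbf{1}$ and $\pi^{(\lfloor p\rfloor)}(S_n(x)_{0,t})=x_0^{-1}x_t$ for all $t$. The signature $S(x)=S(x)_{0,T}\in\tilde{T}((V))$ is the unique element with $\pi^{(n)}(S(x)_{0,T})=S_n(x)_{0,T}$ for all $n\ge\lfloor p\rfloor$. $\tilde{T}_{i.r.c.}((V))$ is the set of $a\in\tilde{T}((V))$ with $\|a\|:=\sup_{k\ge1}\|\pi_k(a)\|_{V^{\otimes k}}^{1/k}<\infty$; signatures lie in this set, and $d(a,b)=\|a^{-1}\otimes b\|$ for $a,b\in\tilde{T}_{i.r.c.}((V))$. *)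

(* Defs.v *)
From mathcomp Require Import all_boot all_order all_fingroup all_algebra.
From mathcomp Require Import all_classical all_reals all_analysis.
Import Order.TTheory GRing.Theory Num.Theory.
Import numFieldNormedType.Exports.

Set Implicit Arguments.
Unset Strict Implicit.
Unset Printing Implicit Defensive.

Local Open Scope classical_set_scope.
Local Open Scope ring_scope.

(* Transport of a homogeneous element along an equality of degrees. *)
Definition degcast (F : nat -> Type) (m n : nat) (e : m = n) (x : F m) : F n :=
  eq_rect m F x n e.

Definition subst_at (U : Type) (k : nat) (v : k.-tuple U) (i : 'I_k) (x : U) :
  k.-tuple U := [tuple if j == i then x else tnth v j | j < k].

Definition multilinear (R : realType) (V W : lmodType R) (k : nat)
    (f : k.-tuple V -> W) : Prop :=
  forall (v : k.-tuple V) (i : 'I_k) (c : R) (x y : V),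
    f (subst_at v i (c *: x + y)) =
    c *: f (subst_at v i x) + f (subst_at v i y).

Definition lin_span (R : realType) (W : lmodType R) (S : set W) : set W :=
  [set w | exists (n : nat) (c : 'I_n -> R) (s : 'I_n -> W),
     (forall i, S (s i)) /\ w = \sum_(i < n) c i *: s i].

(* The algebraic tensor powers [talg k] of V, given by their universal property
   and equipped with norms, together with their completions [tpow k].  The
   degree 0 power is R through c |-> c *: pure [tuple], the degree 1 power is V
   through v |-> pure [tuple v]. *)
Record tensorPowers (R : realType) (V : completeNormedModType R) := TensorPowers {
  talg : nat -> normedModType R;
  pure : forall k, k.-tuple V -> talg k;
  pure_multilinear : forall k, multilinear (@pure k);
  pure_universal : forall k (W : lmodType R) (f : k.-tuple V -> W),
    multilinear f ->
    exists g : {linear talg k -> W},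
      (forall v, g (pure v) = f v) /\
      forall g' : {linear talg k -> W}, (forall v, g' (pure v) = f v) -> g' =1 g;
  amul : forall m n, talg m -> talg n -> talg (m + n)%N;
  amul_linearl : forall m n (b : talg n), linear (fun a : talg m => amul a b);
  amul_linearr : forall m n (a : talg m), linear (fun b : talg n => amul a b);
  amul_pure : forall m n (u : m.-tuple V) (v : n.-tuple V),
    amul (pure u) (pure v) = pure (cat_tuple u v);
  norm_pure0 : `|pure [tuple]| = 1;
  norm_pure1 : forall v : V, `|pure [tuple v]| = `|v|;
  norm_amul : forall m n (a : talg m) (b : talg n), `|amul a b| <= `|a| * `|b|;
  norm_perm : forall n (s : 'S_n) (g : {linear talg n -> talg n}),
    (forall v : n.-tuple V, g (pure v) = pure [tuple tnth v (s i) | i < n]) ->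
    forall a, `|g a| = `|a|;
  tpow : nat -> completeNormedModType R;
  tinj : forall k, {linear talg k -> tpow k};
  tinj_isometry : forall k (a : talg k), `|tinj k a| = `|a|;
  tinj_dense : forall k, dense (range (tinj k));
  tmul : forall m n, tpow m -> tpow n -> tpow (m + n)%N;
  tmul_linearl : forall m n (b : tpow n), linear (fun a : tpow m => tmul a b);
  tmul_linearr : forall m n (a : tpow m), linear (fun b : tpow n => tmul a b);
  norm_tmul : forall m n (a : tpow m) (b : tpow n), `|tmul a b| <= `|a| * `|b|;
  tmul_tinj : forall m n (a : talg m) (b : talg n),
    tmul (tinj m a) (tinj n b) = tinj (m + n)%N (amul a b)
}.

Arguments pure {R V} t {k} _.
Arguments amul {R V} t {m n} _ _.
Arguments tmul {R V} t {m n} _ _.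

Section TensorSeries.
Context {R : realType} {V : completeNormedModType R} (X : tensorPowers V).

(* Truncated series of level n are represented as the series that vanish in
   degrees larger than n. *)
Definition tseries : Type := forall k : nat, tpow X k.

Definition trunc (n : nat) (a : tseries) : tseries :=
  fun k => if (k <= n)%N then a k else 0.

Definition sone : tseries :=
  fun k => if k is 0%N then tinj X 0%N (pure X [tuple]) else 0.

Definition ssub (a b : tseries) : tseries := fun k => a k - b k.

Definition smul (a b : tseries) : tseries := fun k =>
  \sum_(i < k.+1) degcast (F := fun j => tpow X j) (subnKC (leq_ord i))
                          (tmul X (a i) (b (k - i)%N)).

Definition spow (a : tseries) (j : nat) : tseries := iter j (smul a) sone.

(* Inverse of a series with a 0 = 1, as the series of (-1)^j (a - 1)^j; since
   a - 1 has no term of degree 0, only j <= k contribute in degree k. *)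
Definition sinv (a : tseries) : tseries := fun k =>
  \sum_(j < k.+1) (-1) ^+ j *: spow (ssub a sone) j k.

Definition Tfull : set tseries := [set a | a 0%N = sone 0%N].

Definition Ttrunc (n : nat) : set tseries :=
  [set a | a 0%N = sone 0%N /\ forall k, (n < k)%N -> a k = 0].

Definition mulT (n : nat) (a b : tseries) : tseries := trunc n (smul a b).
Definition invT (n : nat) (a : tseries) : tseries := trunc n (sinv a).

Definition normT (n : nat) (a : tseries) : R :=
  \big[Num.max/0]_(1 <= k < n.+1) (`|a k| `^ (k%:R^-1)).

(* [lieA k] is L_a^(k+1)(V) *)
Fixpoint lieA (k : nat) : set (talg X k.+1) :=
  match k return set (talg X k.+1) with
  | 0%N => range (fun v : V => pure X [tuple v])
  | j.+1 => lin_span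
      [set z : talg X j.+2 | exists (x : talg X j.+1) (v : V), lieA x /\
         z = degcast (F := fun i => talg X i) (addn1 j.+1)
               (amul X x (pure X [tuple v]))
             - (amul X (pure X [tuple v]) x : talg X j.+2)]
  end.

Definition lieT (n : nat) : set tseries :=
  [set l | l 0%N = 0 /\
     (forall k, (k < n)%N -> exists2 x, lieA x & l k.+1 = tinj X k.+1 x) /\
     (forall k, (n < k)%N -> l k = 0)].

Definition expT (n : nat) (l : tseries) : tseries :=
  trunc n (fun k => \sum_(j < n.+1) (j`!%:R : R)^-1 *: spow l j k).

Definition groupG (n : nat) : set tseries :=
  [set g | Ttrunc n g /\
     exists h : nat -> tseries, (forall m, (expT n @` lieT n) (h m)) /\
       forall k, (k <= n)%N -> (fun m => h m k) @ \oo --> g k].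

Definition pvar (n : nat) (p T : R) (x : R -> tseries) : \bar R :=
  ereal_sup [set ((\sum_(0 <= j < size s)
      normT n (mulT n (invT n (x (nth T (0 :: s) j)))
                      (x (nth T (0 :: s) j.+1))) `^ p) `^ p^-1)%:E
    | s in itv_partition 0 T].

Definition continuous_path (n : nat) (T : R) (x : R -> tseries) : Prop :=
  forall k, (k <= n)%N -> {within `[0, T], continuous (fun t => x t k)}.

Definition WGOmega (p T : R) (x : R -> tseries) : Prop :=
  [/\ continuous_path (Num.truncn p) T x,
      forall t, t \in `[0, T] -> groupG (Num.truncn p) (x t)
    & (pvar (Num.truncn p) p T x < +oo)%E].

Definition unif_dist (p T : R) (x y : R -> tseries) : \bar R :=
  ereal_sup [set (normT (Num.truncn p) (ssub (x t) (y t)))%:E | t in `[0, T]].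

(* [is_lift p T n x S]: S is Lyons' extension S_n(x)_{0,.} of x to level n. *)
Definition is_lift (p T : R) (n : nat) (x S : R -> tseries) : Prop :=
  [/\ forall t, t \in `[0, T] -> Ttrunc n (S t),
      continuous_path n T S,
      (pvar n p T S < +oo)%E,
      S 0 = sone
    & forall t, t \in `[0, T] ->
        trunc (Num.truncn p) (S t) =
        mulT (Num.truncn p) (invT (Num.truncn p) (x 0)) (x t)].

Definition is_signature (p T : R) (x : R -> tseries) (s : tseries) : Prop :=
  Tfull s /\
  forall n, (Num.truncn p <= n)%N ->
    exists2 S, is_lift p T n x S & trunc n s = S T.

Definition norm_irc (a : tseries) : \bar R :=
  ereal_sup [set (`|a k| `^ (k%:R^-1))%:E | k in [set k | (1 <= k)%N]].

Definition dist_irc (a b : tseries) : \bar R := norm_irc (smul (sinv a) b).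

End TensorSeries.

(* Main.v *)
Require Import Defs.
From HB Require Import structures.
From mathcomp Require Import all_boot all_order all_algebra.
From mathcomp Require Import all_classical all_reals all_analysis.
From mathcomp Require Import ring lra.
Import Order.TTheory GRing.Theory Num.Theory.
Import numFieldNormedType.Exports.

Set Implicit Arguments.
Unset Strict Implicit.
Unset Printing Implicit Defensive.

Local Open Scope classical_set_scope.
Local Open Scope ring_scope.

(** The whole sequence of signatures converges, so the identity serves as the
    subsequence.  Everything is an a priori estimate on an arbitrary lift.

    Write [inc S s t] for [S_s^-1 * S_t]; Chen's relation makes increments
    multiplicative, and the [p]-variation yields a nondecreasing function [v]
    such that the [p]-th power of the homogeneous norm of [inc x s t] is at most
    [v t - v s] ([pvar_control]).  Lyons' argument bounds the degrees above [p]
    of a lift by the lower ones: the part of degree [k + 1] is additive in time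
    up to products of lower degrees, and it is negligible on fine grids because
    the lift is continuous with finite [p]-variation, hence it is bounded by its
    defect of additivity ([sewing_bound]).  A geometric bound
    [b ^ k * (v t - v s) ^ ((k + 1) / q)], without factorials, is reproduced by
    the induction with a constant [b] that does not depend on the degree
    ([lyons_bound]).

    Uniform convergence gives no control on how the [p]-variation of [x n]
    spreads over time.  This is repaired by an exponent [q] strictly between [p]
    and [floor p + 1]: where increments have norm at most [eta], the function
    [eta ^ (q - p) * v] controls their [q]-th power.  As [y] is uniformly
    continuous and the increments of [x n] converge uniformly to those of [y],
    the interval [[0, T]] can be cut into [M] cells, for all large [n] at once,
    on which all increments have norm at most [eta], and hence all increments
    of the lifts have in degree [k] a norm at most [rho ^ k], where [rho] tends
    to 0 with [eta] ([cell_bound], [uniformly_small_steps]).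

    Two consequences give the distance.  Multiplying over the cells, the degree
    [k] of [s_n^-1 * s_y] is at most [4 ^ M * (4 * rho) ^ k], whose [k]-th root
    is below any prescribed number for large [k], uniformly in [n]
    ([high_degrees]).  For the finitely many remaining degrees, the difference
    of the signatures telescopes over the cells: on each cell the degrees up to
    [p] are close by uniform convergence, and the higher degrees are at most a
    multiple of [rho ^ q] times the share of the cell in the total variation
    ([lift_diff_bound], [low_degrees]). *)

(** * The completed tensor powers, up to transport of degrees *)

Section TensorAlgebra.
Context {R : realType} {V : completeNormedModType R} (X : tensorPowers V).

(** Transport of degrees without a proof of equality: [redeg k] is defined on
    every degree and vanishes on those other than [k].  Sums over all pairs of
    degrees then make sense, and can be exchanged. *)
Definition redeg (m k : nat) (z : tpow X m) : tpow X k :=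
  match m =P k with
  | ReflectT e => degcast (F := fun j => tpow X j) e z
  | ReflectF _ => 0
  end.

Lemma redeg_degcast m k (e : m = k) (z : tpow X m) :
  redeg k z = degcast (F := fun j => tpow X j) e z.
Proof.
rewrite /redeg; case: eqP => [e'|//].
by rewrite (eq_irrelevance e' e).
Qed.

Lemma redeg_id m (z : tpow X m) : redeg m z = z.
Proof. by rewrite (redeg_degcast erefl). Qed.

Lemma redeg_neq m k (z : tpow X m) : m != k -> redeg k z = 0.
Proof. by rewrite /redeg; case: eqP. Qed.

Lemma redeg_linear m k : linear (@redeg m k).
Proof.
move=> c x y; have [e|ne] := eqVneq m k.
  by case: k / e; rewrite !redeg_id.
by rewrite !redeg_neq// scaler0 addr0.
Qed.

HB.instance Definition _ m k :=
  GRing.isLinear.Build R (tpow X m) (tpow X k) _ _ (@redeg_linear m k).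

Lemma norm_redeg m k (z : tpow X m) : `|redeg k z| <= `|z|.
Proof.
have [e|ne] := eqVneq m k; first by case: k / e; rewrite redeg_id.
by rewrite redeg_neq// normr0.
Qed.

Lemma redeg_pure m n k (u : m.-tuple V) (v : n.-tuple V) :
  u = v :> seq V ->
  redeg k (tinj X m (pure X u)) = redeg k (tinj X n (pure X v)).
Proof.
move=> uv; have e : m = n by rewrite -(size_tuple u) -(size_tuple v) uv.
case: n / e v uv => v uv; congr (redeg k (tinj X m (pure X _))).
exact: val_inj.
Qed.

HB.instance Definition _ m n (a : tpow X m) :=
  GRing.isLinear.Build R (tpow X n) (tpow X (m + n)) _ (@tmul R V X m n a)
    (tmul_linearr a).

Lemma tmulBl m n (a a' : tpow X m) (b : tpow X n) :
  tmul X (a - a') b = tmul X a b - tmul X a' b.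
Proof.
by rewrite -[- a']scaleN1r addrC tmul_linearl scaleN1r addrC.
Qed.

Lemma tmul_suml m n I (r : seq I) (P : pred I) (a : I -> tpow X m)
    (b : tpow X n) :
  tmul X (\sum_(i <- r | P i) a i) b = \sum_(i <- r | P i) tmul X (a i) b.
Proof.
apply: (big_morph (fun a => tmul X a b)) => [x y|].
  by have := tmul_linearl b 1 x y; rewrite !scale1r.
by rewrite -(subrr 0) tmulBl subrr.
Qed.

(** Pure tensors span the algebraic power, which is dense in the completed one.
    This is how identities of the completed product are verified. *)
Lemma linear_pure_eq0 k (W : normedModType R) (C : R) (f : tpow X k -> W) :
  linear f -> (forall a, `|f a| <= C * `|a|) ->
  (forall v, f (tinj X k (pure X v)) = 0) -> forall a, f a = 0.
Proof.
move=> fl fC fp.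
have ft : forall b, f (tinj X k b) = 0.
  have [|g [_ gu]] := @pure_universal R V X k W (fun=> 0).
    by move=> *; rewrite scaler0 addr0.
  have ftl : linear (f \o tinj X k) by move=> c x y; rewrite /= linearP fl.
  pose ft : {linear talg X k -> W} := HB.pack (f \o tinj X k)
    (GRing.isLinear.Build R (talg X k) W _ (f \o tinj X k) ftl).
  move=> b; have -> : f (tinj X k b) = g b by apply: (gu ft).
  by symmetry; apply: (gu (\0 : {linear talg X k -> W})).
have fB a b : f (a - b) = f a - f b.
  by rewrite -[- b]scaleN1r addrC fl scaleN1r addrC.
move=> a; apply/eqP; rewrite -normr_le0; apply/ler_addgt0Pr => e e0.
rewrite add0r.
have C0 : 0 < `|C| + 1 by rewrite ltr_wpDl.
have d0 : 0 < e / (`|C| + 1) by rewrite divr_gt0.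
have [z [/= ab [b _ eb]]] : ball a (e / (`|C| + 1)) `&` range (tinj X k) !=set0.
  by apply: tinj_dense; [exists a; exact: ballxx | exact: ball_open].
move: ab; rewrite -{}eb -ball_normE /= => /ltW ab.
have -> : f a = f (a - tinj X k b) by rewrite fB ft subr0.
apply: le_trans (fC _) _.
rewrite -(divfK (lt0r_neq0 C0) e) mulrC.
apply: le_trans (_ : `|a - tinj X k b| * (`|C| + 1) <= _).
  by rewrite ler_wpM2l// (le_trans (ler_norm _))// lerDl.
by rewrite ler_wpM2r// ltW.
Qed.

Lemma linear_pure_eq k (W : normedModType R) (C D : R) (f g : tpow X k -> W) :
  linear f -> linear g ->
  (forall a, `|f a| <= C * `|a|) -> (forall a, `|g a| <= D * `|a|) ->
  (forall v, f (tinj X k (pure X v)) = g (tinj X k (pure X v))) -> f =1 g.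
Proof.
move=> fl gl fC gD fg a; apply/eqP; rewrite -subr_eq0; apply/eqP.
apply: (@linear_pure_eq0 k W (C + D) (fun a => f a - g a)).
- by move=> c x y; rewrite fl gl scalerBr opprD addrACA.
- by move=> b; rewrite mulrDl (le_trans (ler_normB _ _))// lerD.
- by move=> v; rewrite fg subrr.
Qed.

Lemma norm_sone0 : `|sone X 0%N| = 1.
Proof. by rewrite /= tinj_isometry norm_pure0. Qed.

(** Units and associativity hold up to the transport of degrees done by
    [redeg]; on pure tensors both sides are the same concatenation. *)
Lemma redeg_mul1 m k (a : tpow X m) :
  redeg k (tmul X (sone X 0%N) a) = redeg k a.
Proof.
move: a; apply: (@linear_pure_eq m _ 1 1).
- by move=> c x y; rewrite !linearP.
- exact: redeg_linear.
- move=> a; rewrite (le_trans (norm_redeg _ _))// (le_trans (norm_tmul _ _))//.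
  by rewrite norm_sone0.
- by move=> a; rewrite mul1r norm_redeg.
- by move=> v; rewrite tmul_tinj amul_pure; apply: redeg_pure.
Qed.

Lemma redeg_mulr1 m k (a : tpow X m) :
  redeg k (tmul X a (sone X 0%N)) = redeg k a.
Proof.
move: a; apply: (@linear_pure_eq m _ 1 1).
- by move=> c x y; rewrite tmul_linearl linearP.
- exact: redeg_linear.
- move=> a; rewrite (le_trans (norm_redeg _ _))// (le_trans (norm_tmul _ _))//.
  by rewrite norm_sone0 mulr1 mul1r.
- by move=> a; rewrite mul1r norm_redeg.
- by move=> v; rewrite tmul_tinj amul_pure; apply: redeg_pure; rewrite /= cats0.
Qed.

Lemma redeg_mulA m n l k (a : tpow X m) (b : tpow X n) (c : tpow X l) :
  redeg k (tmul X (tmul X a b) c) = redeg k (tmul X a (tmul X b c)).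
Proof.
have bl a' b' c' :
    `|redeg k (tmul X (tmul X a' b') c')| <= `|a'| * `|b'| * `|c'|.
  rewrite (le_trans (norm_redeg _ _))// (le_trans (norm_tmul _ _))//.
  by rewrite ler_wpM2r// norm_tmul.
have br a' b' c' :
    `|redeg k (tmul X a' (tmul X b' c'))| <= `|a'| * `|b'| * `|c'|.
  rewrite (le_trans (norm_redeg _ _))// (le_trans (norm_tmul _ _))//.
  by rewrite -mulrA ler_wpM2l// norm_tmul.
move: a; apply: (@linear_pure_eq m _ (`|b| * `|c|) (`|b| * `|c|)).
- by move=> t x y; rewrite !tmul_linearl linearP.
- by move=> t x y; rewrite tmul_linearl linearP.
- by move=> a; rewrite mulrC mulrA; apply: bl.
- by move=> a; rewrite mulrC mulrA; apply: br.
move=> u; set a := tinj _ _ _.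
move: b; apply: (@linear_pure_eq n _ (`|a| * `|c|) (`|a| * `|c|)).
- by move=> t x y; rewrite tmul_linearr tmul_linearl linearP.
- by move=> t x y; rewrite tmul_linearl tmul_linearr linearP.
- by move=> b; rewrite mulrAC; apply: bl.
- by move=> b; rewrite mulrAC; apply: br.
move=> v; set b := tinj _ _ _.
move: c; apply: (@linear_pure_eq l _ (`|a| * `|b|) (`|a| * `|b|)) => //.
- by move=> t x y; rewrite tmul_linearr linearP.
- by move=> t x y; rewrite !tmul_linearr linearP.
move=> w; rewrite !tmul_tinj !amul_pure; apply: redeg_pure.
by rewrite /= catA.
Qed.

End TensorAlgebra.

(** * The ring of tensor series *)

Section SeriesRing.
Context {R : realType} {V : completeNormedModType R} (X : tensorPowers V).
Implicit Types a b c : tseries X.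

Definition szero : tseries X := fun=> 0.
Definition sopp a : tseries X := fun k => - a k.
Definition sadd a b : tseries X := fun k => a k + b k.

Lemma tseriesP a b : a = b <-> forall k, a k = b k.
Proof. by split=> [->//|ab]; apply: functional_extensionality_dep. Qed.

Lemma saddA : associative sadd.
Proof. by move=> a b c; apply/tseriesP => k; rewrite /sadd addrA. Qed.
Lemma saddC : commutative sadd.
Proof. by move=> a b; apply/tseriesP => k; rewrite /sadd addrC. Qed.
Lemma sadd0 : left_id szero sadd.
Proof. by move=> a; apply/tseriesP => k; rewrite /sadd add0r. Qed.
Lemma saddN : left_inverse szero sopp sadd.
Proof. by move=> a; apply/tseriesP => k; rewrite /sadd addNr. Qed.


Lemma smul_redeg k a b :
  smul a b k = \sum_(i < k.+1) redeg k (tmul X (a i) (b (k - i)%N)).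
Proof.
by apply: eq_bigr => i _; rewrite (redeg_degcast (subnKC (leq_ord i))).
Qed.

(** In the square of indices [i, j <= n] only the antidiagonal [i + j = k]
    contributes; a range that does not depend on the index lets the sums of
    [smulA] be exchanged. *)
Lemma smul_square n k a b : (k <= n)%N ->
  smul a b k = \sum_(i < n.+1) \sum_(j < n.+1) redeg k (tmul X (a i) (b j)).
Proof.
move=> kn; rewrite smul_redeg.
rewrite (big_ord_widen n.+1 (fun i => redeg k (tmul X (a i) (b (k - i)%N))))//.
rewrite big_mkcond /=; apply: eq_bigr => i _; case: ifPn => ik.
  have jn : (k - i < n.+1)%N by rewrite ltnS (leq_trans (leq_subr _ _)).
  rewrite (bigD1 (Ordinal jn))//= big1 ?addr0// => j jk.
  rewrite redeg_neq//; apply: contra jk => /eqP ijk.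
  by rewrite -val_eqE /= -ijk addKn.
rewrite big1// => j _; rewrite redeg_neq//; apply: contra ik => /eqP <-.
by rewrite ltnS leq_addr.
Qed.

Lemma redeg_tmul_redeg_l m n l k (z : tpow X m) (c : tpow X l) :
  (m <= n)%N -> redeg k (tmul X z c) =
  \sum_(i < n.+1) redeg k (tmul X (redeg i z) c).
Proof.
move=> mn; have mn' : (m < n.+1)%N by [].
rewrite (bigD1 (Ordinal mn'))//= redeg_id big1 ?addr0// => i im.
rewrite (redeg_neq z); last by move: im; rewrite -val_eqE eq_sym.
by rewrite -(subrr 0) tmulBl subrr linear0.
Qed.

Lemma redeg_tmul_redeg_r m n l k (z : tpow X m) (c : tpow X l) :
  (m <= n)%N -> redeg k (tmul X c z) =
  \sum_(i < n.+1) redeg k (tmul X c (redeg i z)).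
Proof.
move=> mn; have mn' : (m < n.+1)%N by [].
rewrite (bigD1 (Ordinal mn'))//= redeg_id big1 ?addr0// => i im.
rewrite (redeg_neq z); last by move: im; rewrite -val_eqE eq_sym.
by rewrite !linear0.
Qed.

Lemma smulA : associative (@smul R V X).
Proof.
move=> a b c; apply/tseriesP => k.
pose t i j l := redeg k (tmul X (a i) (tmul X (b j) (c l))).
transitivity (\sum_(i < k.+1) \sum_(j < k.+1) \sum_(l < k.+1) t i j l).
  rewrite (smul_square _ _ (leqnn k)); apply: eq_bigr => i _.
  under eq_bigr => m _ do rewrite (smul_square _ _ (leq_ord m)).
  rewrite (eq_bigr (fun m : 'I_k.+1 => \sum_(j < k.+1) \sum_(l < k.+1)
     redeg k (tmul X (a i) (redeg m (tmul X (b j) (c l)))))); last first.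
    move=> m _; rewrite linear_sum linear_sum; apply: eq_bigr => j _.
    by rewrite linear_sum linear_sum.
  rewrite exchange_big /=; apply: eq_bigr => j _.
  rewrite exchange_big /=; apply: eq_bigr => l _.
  have [jl|jl] := leqP (j + l) k; first by rewrite -redeg_tmul_redeg_r.
  rewrite big1 => [|m _]; last first.
    rewrite (redeg_neq (tmul X (b j) (c l))) ?linear0//.
    by rewrite gtn_eqF// (leq_ltn_trans (leq_ord m) jl).
  by rewrite /t redeg_neq// gtn_eqF// (leq_trans jl)// leq_addl.
rewrite (smul_square _ _ (leqnn k)).
rewrite [RHS](eq_bigr (fun m : 'I_k.+1 => \sum_(l < k.+1)
   \sum_(i < k.+1) \sum_(j < k.+1)
     redeg k (tmul X (redeg m (tmul X (a i) (b j))) (c l)))); last first.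
  move=> m _; apply: eq_bigr => l _.
  rewrite (smul_square _ _ (leq_ord m)) tmul_suml linear_sum.
  by apply: eq_bigr => i _; rewrite tmul_suml linear_sum.
rewrite [RHS]exchange_big /=.
under [RHS]eq_bigr => l _ do rewrite exchange_big /=.
rewrite [RHS]exchange_big /=; apply: eq_bigr => i _.
under [RHS]eq_bigr => l _ do rewrite exchange_big /=.
rewrite [RHS]exchange_big /=; apply: eq_bigr => j _.
apply: eq_bigr => l _; rewrite /t -redeg_mulA.
have [ij|ij] := leqP (i + j) k; first by rewrite -redeg_tmul_redeg_l.
rewrite big1 => [|m _]; last first.
  rewrite (redeg_neq (tmul X (a i) (b j))); last first.
    by rewrite gtn_eqF// (leq_ltn_trans (leq_ord m) ij).
  by rewrite -(subrr 0) tmulBl subrr linear0.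
by rewrite redeg_neq// gtn_eqF// (leq_trans ij)// leq_addr.
Qed.

Lemma smul1 : left_id (sone X) (@smul R V X).
Proof.
move=> a; apply/tseriesP => k; rewrite smul_redeg big_ord_recl /= subn0.
rewrite redeg_mul1 redeg_id big1 ?addr0// => i _.
by rewrite -(subrr 0) tmulBl subrr linear0.
Qed.

Lemma smulr1 : right_id (sone X) (@smul R V X).
Proof.
move=> a; apply/tseriesP => k; rewrite smul_redeg big_ord_recr /= subnn.
rewrite redeg_mulr1 redeg_id big1 ?add0r// => i _.
case E : (k - i)%N => [|l]; last by rewrite !linear0.
by move: (ltn_ord i); rewrite -subn_gt0 E.
Qed.

Lemma smulDl : left_distributive (@smul R V X) sadd.
Proof.
move=> a b c; apply/tseriesP => k; rewrite /sadd !smul_redeg -big_split /=.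
apply: eq_bigr => i _; have := tmul_linearl (c (k - i)%N) 1 (a i) (b i).
by rewrite !scale1r => ->; rewrite linearD.
Qed.

Lemma smulDr : right_distributive (@smul R V X) sadd.
Proof.
move=> a b c; apply/tseriesP => k; rewrite /sadd !smul_redeg -big_split /=.
by apply: eq_bigr => i _; rewrite !linearD.
Qed.

HB.instance Definition _ := gen_eqMixin (tseries X).
HB.instance Definition _ := gen_choiceMixin (tseries X).
HB.instance Definition _ := GRing.isZmodule.Build (tseries X)
  saddA saddC sadd0 saddN.
HB.instance Definition _ := GRing.Zmodule_isPzRing.Build (tseries X)
  smulA smul1 smulr1 smulDl smulDr.

End SeriesRing.

(** * Inverses and growth of series *)

Section SeriesInverse.
Context {R : realType} {V : completeNormedModType R} (X : tensorPowers V).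
Implicit Types a b c : tseries X.

Lemma addsE a b k : (a + b) k = a k + b k. Proof. by []. Qed.
Lemma subsE a b k : (a - b) k = a k - b k. Proof. by []. Qed.
Lemma oneS k : (1 : tseries X) k.+1 = 0. Proof. by []. Qed.

Lemma mulsE_redeg a b k :
  (a * b) k = \sum_(i < k.+1) redeg k (tmul X (a i) (b (k - i)%N)).
Proof. exact: smul_redeg. Qed.

Lemma norm_muls a b k :
  `|(a * b) k| <= \sum_(i < k.+1) `|a i| * `|b (k - i)%N|.
Proof.
rewrite mulsE_redeg (le_trans (ler_norm_sum _ _ _))// ler_sum// => i _.
by rewrite (le_trans (norm_redeg _ _))// norm_tmul.
Qed.

Lemma sums_at I (r : seq I) (P : pred I) (F : I -> tseries X) k :
  (\sum_(i <- r | P i) F i) k = \sum_(i <- r | P i) F i k.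
Proof. exact: (big_morph (fun a : tseries X => a k)). Qed.

Lemma muls0 a b : a 0%N = sone X 0%N -> b 0%N = sone X 0%N ->
  (a * b) 0%N = sone X 0%N.
Proof.
move=> a0 b0; rewrite mulsE_redeg big_ord_recl big_ord0 addr0 a0 b0.
by rewrite redeg_mul1 redeg_id.
Qed.

Lemma muls_local a a' b b' k :
  (forall i, (i <= k)%N -> a i = a' i) ->
  (forall i, (i <= k)%N -> b i = b' i) ->
  (a * b) k = (a' * b') k.
Proof.
move=> aa bb; rewrite !mulsE_redeg; apply: eq_bigr => i _.
by rewrite aa ?leq_ord// bb// leq_subr.
Qed.

Lemma spowE a j : spow a j = a ^+ j.
Proof. by elim: j => [//|j IH]; rewrite exprS -IH. Qed.

Lemma sinvE a k : sinv a k = \sum_(j < k.+1) (-1) ^+ j *: ((a - 1) ^+ j) k.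
Proof. by apply: eq_bigr => j _; rewrite spowE. Qed.

Lemma exp_low a j k : a 0%N = 0 -> (k < j)%N -> (a ^+ j) k = 0.
Proof.
move=> a0; elim: j k => [//|j IH] k kj.
rewrite exprS mulsE_redeg big1// => -[[|i] ik] _ /=.
  by rewrite a0 -(subrr 0) tmulBl subrr linear0.
rewrite IH ?linear0//; move: ik kj; rewrite !ltnS; case: k => [//|k].
by rewrite subSS => _ kj; rewrite (leq_ltn_trans (leq_subr _ _)).
Qed.

(** The terms added beyond [k] vanish in degree [k]; with a number of terms
    common to all degrees, the series is a polynomial in [1 - a]. *)
Lemma sinv_geom n a k : a 0%N = sone X 0%N -> (k <= n)%N ->
  sinv a k = (\sum_(j < n.+1) (1 - a) ^+ j) k.
Proof.
move=> a0 kn; rewrite sinvE sums_at (big_ord_widen n.+1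
  (fun j => (-1) ^+ j *: ((a - 1) ^+ j) k))// big_mkcond /=.
apply: eq_bigr => j _; have -> : (1 - a) ^+ j = (a - 1) ^+ j * (-1) ^+ j.
  by rewrite -exprMn_comm ?mulrN1 ?opprB//; exact: commrN1.
have -> : ((a - 1) ^+ j * (-1) ^+ j) k = (-1) ^+ j *: ((a - 1) ^+ j) k.
  rewrite -signr_odd -(signr_odd R); case: odd => /=.
    by rewrite !expr1 mulrN1 scaleN1r.
  by rewrite !expr0 mulr1 scale1r.
case: ifPn => // jk; rewrite exp_low ?scaler0//.
  by rewrite subsE a0 subrr.
by rewrite ltnNge -ltnS.
Qed.

Lemma sinv0 a : a 0%N = sone X 0%N -> sinv a 0%N = sone X 0%N.
Proof. by move=> a0; rewrite (sinv_geom a0 (leqnn 0)) big_ord1 expr0. Qed.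

Lemma exp_local a a' k j : (forall i, (i <= k)%N -> a i = a' i) ->
  (a ^+ j) k = (a' ^+ j) k.
Proof.
elim: j k => [//|j IH] k aa; rewrite !exprS; apply: muls_local => // i ik.
by apply: IH => l li; apply: aa; apply: leq_trans ik.
Qed.

Lemma sinv_local a a' k : (forall i, (i <= k)%N -> a i = a' i) ->
  sinv a k = sinv a' k.
Proof.
move=> aa; rewrite !sinvE; apply: eq_bigr => j _; congr (_ *: _).
by apply: exp_local => i ik; rewrite !subsE aa.
Qed.

Lemma mulsV a : a 0%N = sone X 0%N -> a * sinv a = 1.
Proof.
move=> a0; apply/tseriesP => k.
pose g := \sum_(j < k.+1) (1 - a) ^+ j.
rewrite (muls_local (a' := a) (b' := g))//; last first.
  by move=> i ik; rewrite (sinv_geom a0 ik).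
have -> : a * g = 1 - (1 - a) ^+ k.+1.
  rewrite -[RHS]opprB subrX1 -mulNr; congr (_ * _).
  by rewrite addrAC subrr add0r opprK.
by rewrite subsE exp_low ?subr0// subsE a0 subrr.
Qed.

Lemma mulVs a : a 0%N = sone X 0%N -> sinv a * a = 1.
Proof.
move=> a0; have i0 := sinv0 a0.
(* A right inverse that has a right inverse itself is two-sided. *)
have {2}-> : a = sinv (sinv a).
  by rewrite -[LHS]mulr1 -(mulsV i0) mulrA mulsV// mul1r.
exact: mulsV.
Qed.

Lemma sinv_unique a b : a 0%N = sone X 0%N -> a * b = 1 -> b = sinv a.
Proof. by move=> a0 ab; rewrite -[LHS]mul1r -(mulVs a0) -mulrA ab mulr1. Qed.

Lemma sinvM a b : a 0%N = sone X 0%N -> b 0%N = sone X 0%N ->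
  sinv (a * b) = sinv b * sinv a.
Proof.
move=> a0 b0; symmetry; apply: sinv_unique; first exact: muls0.
by rewrite mulrA -[X in X * _]mulrA mulsV// mulr1 mulsV.
Qed.

Lemma sinvK a : a 0%N = sone X 0%N -> sinv (sinv a) = a.
Proof. by move=> a0; symmetry; apply: sinv_unique; rewrite ?sinv0 ?mulVs. Qed.

(** The number 2 makes up for the [2 ^ k.-1] compositions of [k] that occur in
    degree [k] of an inverse. *)
Lemma norm_sinv n r a : 0 <= r -> a 0%N = sone X 0%N ->
  (forall k, (k <= n)%N -> `|a k| <= r ^+ k) ->
  forall k, (k <= n)%N -> `|sinv a k| <= (2 * r) ^+ k.
Proof.
move=> r0 a0 ar; elim/ltn_ind => -[_ _|k IH kn].
  by rewrite sinv0// norm_sone0 expr0.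
(* The identity a * sinv a = 1, read in degree k.+1, is a recursion. *)
have -> : sinv a k.+1 =
    - \sum_(i < k.+1) redeg k.+1 (tmul X (a i.+1) (sinv a (k - i)%N)).
  have := congr1 (fun c : tseries X => c k.+1) (mulsV a0).
  rewrite mulsE_redeg big_ord_recl oneS a0 redeg_mul1 redeg_id => /eqP.
  by rewrite addr_eq0 => /eqP.
rewrite normrN (le_trans (ler_norm_sum _ _ _))//.
apply: (@le_trans _ _ (\sum_(i < k.+1) r ^+ k.+1 * 2 ^+ (k - i))).
  apply: ler_sum => i _; rewrite (le_trans (norm_redeg _ _))//.
  rewrite (le_trans (norm_tmul _ _))//.
  have ik : (i <= k)%N by rewrite leq_ord.
  have -> : r ^+ k.+1 = r ^+ i.+1 * r ^+ (k - i).
    by rewrite -exprD addSn subnKC.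
  rewrite -mulrA -exprMn [r * 2]mulrC ler_pM// ?ar//.
    by rewrite (leq_ltn_trans ik).
  by apply: IH; rewrite ?ltnS ?leq_subr// (leq_trans (leq_subr _ _))// ltnW.
rewrite -mulr_sumr exprMn mulrC ler_wpM2r ?exprn_ge0//.
rewrite (reindex_inj rev_ord_inj) /=.
under eq_bigr => i _ do rewrite subSS subKn ?leq_ord//.
have := subrX1 (2 : R) k.+1; rewrite (_ : 2 - 1 = 1 :> R); last by ring.
by rewrite mul1r => <-; rewrite lerBlDr lerDl.
Qed.

(** Doubling the radius beforehand makes the Cauchy product a geometric sum, so
    that a further factor only costs the constant 2. *)
Lemma norm_muls_l n C r a b : 0 <= r -> 0 <= C ->
  (forall k, (k <= n)%N -> `|a k| <= r ^+ k) ->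
  (forall k, (k <= n)%N -> `|b k| <= C * (2 * r) ^+ k) ->
  forall k, (k <= n)%N -> `|(a * b) k| <= 2 * C * (2 * r) ^+ k.
Proof.
move=> r0 C0 ar br k kn; rewrite (le_trans (norm_muls _ _ _))//.
apply: (@le_trans _ _ (\sum_(i < k.+1) C * r ^+ k * 2 ^+ (k - i))).
  apply: ler_sum => i _; have ik : (i <= k)%N by rewrite leq_ord.
  have -> : C * r ^+ k * 2 ^+ (k - i) = r ^+ i * (C * (2 * r) ^+ (k - i)).
    have -> : r ^+ k = r ^+ i * r ^+ (k - i) by rewrite -exprD subnKC.
    by rewrite exprMn; ring.
  rewrite ler_pM ?ar ?br// ?(leq_trans ik)//.
  by rewrite (leq_trans (leq_subr _ _)).
rewrite -mulr_sumr (reindex_inj rev_ord_inj) /=.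
under eq_bigr => i _ do rewrite subSS subKn ?leq_ord//.
have := subrX1 (2 : R) k.+1; rewrite (_ : 2 - 1 = 1 :> R); last by ring.
rewrite mul1r => <-; rewrite exprMn exprS.
have : 0 <= C * r ^+ k by rewrite mulr_ge0 ?exprn_ge0.
set x := r ^+ k; set y := 2 ^+ k => Cx.
have -> : 2 * C * (y * x) = C * x * (2 * y) by ring.
by rewrite ler_wpM2l// gerBl.
Qed.

Lemma norm_muls_r n C r a b : 0 <= r -> 0 <= C ->
  (forall k, (k <= n)%N -> `|a k| <= C * (2 * r) ^+ k) ->
  (forall k, (k <= n)%N -> `|b k| <= r ^+ k) ->
  forall k, (k <= n)%N -> `|(a * b) k| <= 2 * C * (2 * r) ^+ k.
Proof.
move=> r0 C0 ar br k kn; rewrite (le_trans (norm_muls _ _ _))//.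
apply: (@le_trans _ _ (\sum_(i < k.+1) C * r ^+ k * 2 ^+ i)).
  apply: ler_sum => i _; have ik : (i <= k)%N by rewrite leq_ord.
  have -> : C * r ^+ k * 2 ^+ i = (C * (2 * r) ^+ i) * r ^+ (k - i).
    have -> : r ^+ k = r ^+ i * r ^+ (k - i) by rewrite -exprD subnKC.
    by rewrite exprMn; ring.
  rewrite ler_pM ?ar ?br// ?(leq_trans ik)//.
  by rewrite (leq_trans (leq_subr _ _)).
rewrite -mulr_sumr.
have := subrX1 (2 : R) k.+1; rewrite (_ : 2 - 1 = 1 :> R); last by ring.
rewrite mul1r => <-; rewrite exprMn exprS.
have : 0 <= C * r ^+ k by rewrite mulr_ge0 ?exprn_ge0.
set x := r ^+ k; set y := 2 ^+ k => Cx.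
have -> : 2 * C * (y * x) = C * x * (2 * y) by ring.
by rewrite ler_wpM2l// gerBl.
Qed.

End SeriesInverse.

(** * Sewing *)

Section Sewing.
Context {R : realType} {W : normedModType R}.

(** Young's argument by bisection.  Let [j] be the last grid point before which
    at most half of the control is spent: then at most half of it is spent after
    [j.+1] too.  Splitting at [j] and [j.+1] costs two defects and leaves two
    grids with half the control, so that the costs form a geometric series of
    ratio [2 * kappa]. *)
Lemma sewing_grid (v : nat -> R) (z : nat -> nat -> W) (phi : R -> R)
    (kappa : R) :
  0 <= kappa -> 2 * kappa < 1 ->
  {homo v : i j / (i <= j)%N >-> i <= j} ->
  (forall w, 0 <= w -> 0 <= phi w) ->
  (forall w w', 0 <= w -> w <= w' -> phi w <= phi w') ->
  (forall w, 0 <= w -> phi (w / 2) <= kappa * phi w) ->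
  (forall i, z i i = 0) ->
  (forall i j k, (i <= j)%N -> (j <= k)%N ->
     `|z i k - z i j - z j k| <= phi (v k - v i)) ->
  forall i k, (i <= k)%N ->
  `|z i k - \sum_(i <= j < k) z j j.+1| <=
    2 / (1 - 2 * kappa) * phi (v k - v i).
Proof.
move=> k0 k1 vmono phi0 phimono phihalf zz zdef i k.
have k2 : 0 < 1 - 2 * kappa by rewrite subr_gt0.
set K := 2 / _; have K0 : 0 <= K by rewrite divr_ge0// ltW.
have KE : 2 + 2 * kappa * K = K by rewrite /K; field; rewrite gt_eqF.
have [d] := ubnP (k - i); elim: d i k => // d IH i k.
rewrite ltnS => kid ik.
have w0 : 0 <= v k - v i by rewrite subr_ge0 vmono.
have [->|ik'] := eqVneq i k.
  by rewrite zz big_geq// subr0 normr0 mulr_ge0// phi0// subrr.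
have {}ik : (i < k)%N by rewrite ltn_neqAle ik'.
pose P j := [&& (i <= j)%N, (j < k)%N & v j <= (v i + v k) / 2].
have Pi : exists j, P j.
  exists i; rewrite /P leqnn ik /=.
  by move: w0; set x := v i; set y := v k; lra.
have Pk j : P j -> (j <= k)%N by case/and3P => _ /ltnW.
case: (ex_maxnP Pi Pk) => j /and3P[ij jk vj] jmax {Pi Pk}.
have vj1 : v k - v j.+1 <= (v k - v i) / 2.
  have [->|j1k] := eqVneq j.+1 k; first by rewrite subrr divr_ge0.
  have {}j1k : (j.+1 < k)%N by rewrite ltn_neqAle j1k.
  have : ~~ P j.+1 by apply/negP => /jmax; rewrite ltnn.
  rewrite /P j1k (leq_trans ij (leqnSn _)) /= -ltNge.
  by set x := v i; set y := v k; set u := v j.+1; lra.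
have vj0 : v j - v i <= (v k - v i) / 2.
  by move: vj; set x := v i; set y := v k; set u := v j; lra.
have w1 : 0 <= v j - v i by rewrite subr_ge0 vmono.
have w2 : 0 <= v k - v j.+1 by rewrite subr_ge0 vmono.
have l1 : `|z i j - \sum_(i <= l < j) z l l.+1| <=
    K * (kappa * phi (v k - v i)).
  apply: le_trans (IH _ _ _ ij) _.
    by rewrite (leq_trans _ kid)// ltn_sub2r.
  by rewrite ler_wpM2l// (le_trans (phimono _ _ w1 vj0))// phihalf.
have l2 : `|z j.+1 k - \sum_(j.+1 <= l < k) z l l.+1| <=
    K * (kappa * phi (v k - v i)).
  apply: le_trans (IH _ _ _ jk) _.
    by rewrite (leq_trans _ kid)// ltn_sub2l.
  by rewrite ler_wpM2l// (le_trans (phimono _ _ w2 vj1))// phihalf.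
have l3 : `|z i k - z i j - z j k| <= phi (v k - v i).
  by apply: zdef => //; exact: ltnW.
have l4 : `|z j k - z j j.+1 - z j.+1 k| <= phi (v k - v i).
  apply: le_trans (zdef _ _ _ (leqnSn j) jk) _.
  by apply: phimono; [rewrite subr_ge0 vmono// ltnW|rewrite lerB// vmono].
rewrite (@big_cat_nat _ _ _ j)//=; last exact: ltnW.
have -> : \sum_(j <= l < k) z l l.+1 =
    z j j.+1 + \sum_(j.+1 <= l < k) z l l.+1 by rewrite big_ltn.
set s1 := \sum_(_ <= _ < j) _ in l1 *; set s2 := \sum_(_ <= _ < k) _ in l2 *.
have -> : z i k - (s1 + (z j j.+1 + s2)) =
    (z i j - s1) + (z j.+1 k - s2) + (z i k - z i j - z j k)
    + (z j k - z j j.+1 - z j.+1 k).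
  apply/eqP; rewrite subr_eq; apply/eqP; symmetry.
  set A := z i k; set B := z i j; set C := z j k; set D := z j j.+1.
  set E := z j.+1 k.
  rewrite [LHS](AC (2*2*3*3*(1*(1*1)))
    (5*((1*6)*(2*11)*(7*8)*(9*12)*(3*10)*(4*13))))/=.
  by rewrite !addrN !addNr !addr0.
rewrite -[X in X * phi _]KE.
have -> : (2 + 2 * kappa * K) * phi (v k - v i) =
    K * (kappa * phi (v k - v i)) + K * (kappa * phi (v k - v i))
    + phi (v k - v i) + phi (v k - v i) by ring.
by do 3!(apply: le_trans (ler_normD _ _) _; apply: lerD => //).
Qed.

(** On a fine grid the sum of the steps is at most [e * (G t - G s)], which
    disappears in the limit: only the defect of additivity is left. *)
Lemma sewing_bound (s t : R) (V G : R -> R) (z : R -> R -> W) (phi : R -> R)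
    (kappa : R) :
  s <= t ->
  0 <= kappa -> 2 * kappa < 1 ->
  {in `[s, t] &, {homo V : a b / a <= b}} ->
  {in `[s, t] &, {homo G : a b / a <= b}} ->
  (forall w, 0 <= w -> 0 <= phi w) ->
  (forall w w', 0 <= w -> w <= w' -> phi w <= phi w') ->
  (forall w, 0 <= w -> phi (w / 2) <= kappa * phi w) ->
  {in `[s, t], forall a, z a a = 0} ->
  (forall a b c, s <= a -> a <= b -> b <= c -> c <= t ->
     `|z a c - z a b - z b c| <= phi (V c - V a)) ->
  (forall e, 0 < e -> exists2 d, 0 < d & forall a b,
     s <= a -> a <= b -> b <= t -> b - a <= d -> `|z a b| <= e * (G b - G a)) ->
  `|z s t| <= 2 / (1 - 2 * kappa) * phi (V t - V s).
Proof.
move=> st k0 k1 Vm Gm phi0 phim phih zz zdef zneg.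
have sI : s \in `[s, t] by rewrite in_itv /= lexx st.
have tI : t \in `[s, t] by rewrite in_itv /= lexx st.
have G0 : 0 <= G t - G s by rewrite subr_ge0 Gm.
apply/ler_addgt0Pr => e e0.
have e'0 : 0 < e / (G t - G s + 1) by rewrite divr_gt0// ltr_wpDl.
have [d d0 zd] := zneg _ e'0.
pose M := (Num.truncn ((t - s) / d)).+1.
have M0 : 0 < M%:R :> R by rewrite ltr0n.
have Md : (t - s) / M%:R <= d.
  rewrite ler_pdivrMr// -ler_pdivrMl// mulrC ltW//.
  by rewrite truncnS_gt.
pose tau i := s + (minn i M)%:R / M%:R * (t - s).
have ts0 : 0 <= t - s by rewrite subr_ge0.
have taum : {homo tau : i j / (i <= j)%N >-> i <= j}.
  move=> i j ij; rewrite lerD2l ler_wpM2r// ler_wpM2r ?invr_ge0 ?ler0n//.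
  by rewrite ler_nat leq_min geq_minr andbT (leq_trans (geq_minl _ _)).
have tau0 : tau 0%N = s by rewrite /tau min0n mul0r mul0r addr0.
have tauM : tau M = t.
  by rewrite /tau minnn divff ?gt_eqF// mul1r addrC subrK.
have tauM' i : tau i <= t.
  rewrite -tauM; have [iM|/ltnW iM] := leqP i M; first exact: taum.
  by rewrite /tau (minn_idPr iM) minnn.
have tau0' i : s <= tau i by rewrite -{1}tau0; apply: taum.
have tauI i : tau i \in `[s, t] by rewrite in_itv /= tau0' tauM'.
have := @sewing_grid (V \o tau) (fun i j => z (tau i) (tau j)) phi kappa k0 k1.
move=> /(_ _ phi0 phim phih _ _ 0%N M (leq0n _)) H.
have {}H : `|z s t - \sum_(0 <= j < M) z (tau j) (tau j.+1)| <=
   2 / (1 - 2 * kappa) * phi (V t - V s).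
  have := H; rewrite /= tau0 tauM; apply.
  - by move=> i j ij; apply: Vm => //; apply: taum.
  - by move=> i; apply: zz.
  - by move=> i j k ij jk; apply: zdef => //; apply: taum.
rewrite -[z s t](subrK (\sum_(0 <= j < M) z (tau j) (tau j.+1))).
rewrite (le_trans (ler_normD _ _))// lerD//.
rewrite (le_trans (ler_norm_sum _ _ _))//.
apply: (@le_trans _ _ (\sum_(0 <= j < M)
   e / (G t - G s + 1) * (G (tau j.+1) - G (tau j)))).
  apply: ler_sum_nat => j /andP[_ jM]; apply: zd => //; first exact: taum.
  rewrite /tau (minn_idPl _)// (minn_idPl _); last exact: ltnW.
  rewrite opprD addrACA subrr add0r -mulrBl -mulrBl -natrB// subSnn.
  by rewrite mul1r mulrC.
rewrite -mulr_sumr telescope_sumr// tau0 tauM mulrAC ler_pdivrMr ?ltr_wpDl//.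
by rewrite ler_wpM2l ?lerDl// ltW.
Qed.

End Sewing.

(** * The a priori bound of Lyons' extension *)

Section MixedSum.
Context {R : realType}.

(** Either factor being at most [l * s] makes this a geometric sum; the bound
    does not depend on the number of terms. *)
Lemma mixed_sum (l s a b : R) k : 0 <= l -> l < 1 ->
  0 <= a -> 0 <= b -> a <= s -> b <= s -> (a <= l * s) || (b <= l * s) ->
  \sum_(i < k) a ^+ i.+1 * b ^+ (k - i) <= s ^+ k.+1 / (1 - l).
Proof.
move=> l0 l1; wlog al : a b / a <= l * s.
  move=> H a0 b0 as_ bs /orP[al|bl]; first by apply: H => //; rewrite al.
  rewrite (reindex_inj rev_ord_inj) /=.
  rewrite (eq_bigr (fun i : 'I_k => b ^+ i.+1 * a ^+ (k - i))) => [|i _].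
    by apply: H => //; rewrite bl.
  by rewrite mulrC subnSK// subKn// ltnW.
move=> a0 b0 as_ bs _.
have s0 : 0 <= s := le_trans a0 as_.
have l1' : 0 < 1 - l by rewrite subr_gt0.
apply: (@le_trans _ _ (\sum_(i < k) s ^+ k.+1 * l ^+ i)).
  apply: ler_sum => i _; have ik := ltn_ord i.
  have -> : s ^+ k.+1 * l ^+ i = (l ^+ i * s ^+ i.+1) * s ^+ (k - i).
    by rewrite -mulrA -exprD addSn subnKC 1?mulrC// ltnW.
  rewrite ler_pM ?exprn_ge0// ?lerXn2r// ?nnegrE//.
  rewrite exprS [s ^+ i.+1]exprS mulrCA -exprMn.
  by rewrite ler_pM ?exprn_ge0// lerXn2r ?nnegrE ?mulr_ge0.
rewrite -mulr_sumr ler_wpM2l ?exprn_ge0//.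
rewrite -[leRHS]mul1r ler_pdivlMr//.
have := subrX1 l k; have : 0 <= l ^+ k by rewrite exprn_ge0.
set S := \sum_(i < k) _; set y := l ^+ k; nra.
Qed.

End MixedSum.

Section LyonsConstant.
Context {R : realType}.
Implicit Types (N k : nat) (q w : R).

(** The factor lost by [w `^ q^-1] when [w] is halved. *)
Definition half_rate q : R := 2^-1 `^ q^-1.

(** The constant of [sewing_bound] times that of [mixed_sum]: the loss at each
    step of the induction on the degree.  The power [N.+1] is the smallest one
    that occurs, and the worst one. *)
Definition lyons_const N q : R :=
  2 / (1 - 2 * half_rate q ^+ N.+1) / (1 - half_rate q).

Lemma half_rate_ge0 q : 0 <= half_rate q. Proof. exact: powR_ge0. Qed.

Lemma powR_half_lt1 (e : R) : 0 < e -> 2^-1 `^ e < 1.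
Proof.
move=> e0; have : 2^-1 `^ e < 1 `^ e.
  by apply: gt0_ltr_powR; rewrite ?nnegrE ?ler01 ?invr_ge0//; lra.
by rewrite powR1.
Qed.

Lemma half_rate_lt1 q : 0 < q -> half_rate q < 1.
Proof.
move=> q0; by apply: powR_half_lt1; rewrite invr_gt0.
Qed.

Lemma half_rate_exp N q : 0 < q -> q < N.+1%:R -> 2 * half_rate q ^+ N.+1 < 1.
Proof.
move=> q0 qN; rewrite /half_rate -powR_mulrn ?powR_ge0// -powRrM.
pose d := q^-1 * N.+1%:R - 1.
have d0 : 0 < d by rewrite subr_gt0 mulrC ltr_pdivlMr// mul1r.
have -> : q^-1 * N.+1%:R = 1 + d by rewrite /d; ring.
rewrite powRD; last by apply/implyP => _; rewrite gt_eqF//; lra.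
by rewrite powRr1 ?invr_ge0// mulrA divff// mul1r powR_half_lt1.
Qed.

Lemma half_rateE q w : 0 <= w -> (w / 2) `^ q^-1 = half_rate q * w `^ q^-1.
Proof. by move=> w0; rewrite powRM// mulrC. Qed.

Lemma lyons_const_ge1 N q : 0 < q -> q < N.+1%:R -> 1 <= lyons_const N q.
Proof.
move=> q0 qN; have h0 := half_rate_ge0 q; have h1 := half_rate_lt1 q0.
have hN := half_rate_exp q0 qN.
have hN0 : 0 <= half_rate q ^+ N.+1 by rewrite exprn_ge0.
rewrite /lyons_const ler_pdivlMr ?subr_gt0// ler_pdivlMr ?subr_gt0//.
by set x := half_rate q in h0 h1 *; set y := _ ^+ _ in hN hN0 *; nra.
Qed.
End LyonsConstant.

Section Increments.
Context {R : realType} {V : completeNormedModType R} (X : tensorPowers V).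
Implicit Types (a b : tseries X) (S : R -> tseries X).

Definition inc S (s t : R) : tseries X := sinv (S s) * S t.

Lemma inc0 S s t : S s 0%N = sone X 0%N -> S t 0%N = sone X 0%N ->
  inc S s t 0%N = sone X 0%N.
Proof. by move=> s0 t0; rewrite /inc muls0// sinv0. Qed.

Lemma inc_refl S s : S s 0%N = sone X 0%N -> inc S s s = 1.
Proof. exact: mulVs. Qed.

(** Chen's relation: the end of an increment cancels against the start of the
    next one. *)
Lemma incM S s u t : S u 0%N = sone X 0%N -> inc S s u * inc S u t = inc S s t.
Proof.
by move=> u0; rewrite /inc mulrA -[X in X * _]mulrA mulsV// mulr1.
Qed.

Lemma norm_muls_mid a b k : a 0%N = sone X 0%N -> b 0%N = sone X 0%N ->
  `|(a * b) k.+1 - a k.+1 - b k.+1| <= \sum_(i < k) `|a i.+1| * `|b (k - i)%N|.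
Proof.
move=> a0 b0; rewrite mulsE_redeg big_ord_recl big_ord_recr /= subSS subnn.
rewrite a0 b0 redeg_mul1 redeg_id.
have -> : redeg k.+1 (tmul X (a k.+1) (sone X 0%N)) = a k.+1.
  by rewrite redeg_mulr1 redeg_id.
set s := \sum_(i < k) _.
have -> : b (k.+1 - 0)%N + (s + a k.+1) - a k.+1 - b k.+1 = s.
  by rewrite addrA addrK addrAC subrr add0r.
rewrite (le_trans (ler_norm_sum _ _ _))// ler_sum// => i _.
by rewrite (le_trans (norm_redeg _ _))// (le_trans (norm_tmul _ _)).
Qed.

(** Lyons' extension estimate with a geometric bound in place of the factorial
    one.  The defect of additivity of degree [k.+1] is a sum of products of
    lower degrees, so that [sewing_bound] gives the next degree; the constant
    is reproduced because [mixed_sum] and the sewing constant are uniform in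
    [k]. *)
Lemma lyons_bound (S : R -> tseries X) (n N : nat) (q a0 b0 : R)
    (v G : R -> R) :
  (0 < N)%N -> 0 < q -> q < N.+1%:R ->
  {in `[a0, b0], forall t, S t 0%N = sone X 0%N} ->
  {in `[a0, b0] &, {homo v : a b / a <= b}} ->
  {in `[a0, b0] &, {homo G : a b / a <= b}} ->
  (forall s t, a0 <= s -> s <= t -> t <= b0 -> forall j, (0 < j <= N)%N ->
     `|inc S s t j| <= ((v t - v s) `^ q^-1) ^+ j) ->
  (forall k, (N < k <= n)%N -> forall e, 0 < e -> exists2 d, 0 < d &
     forall s t, a0 <= s -> s <= t -> t <= b0 -> t - s <= d ->
     `|inc S s t k| <= e * (G t - G s)) ->
  forall k, (k < n)%N -> forall s t, a0 <= s -> s <= t -> t <= b0 ->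
  `|inc S s t k.+1| <= lyons_const N q ^+ k * ((v t - v s) `^ q^-1) ^+ k.+1.
Proof.
move=> N0 q0 qN S0 vm Gm low high.
have h0 := half_rate_ge0 q; have h1 := half_rate_lt1 q0.
have hN := half_rate_exp q0 qN; have b1 := lyons_const_ge1 q0 qN.
set l := half_rate q in h0 h1 hN.
have := erefl (lyons_const N q); rewrite {2}/lyons_const -/l.
move: (lyons_const N q) b1 => B b1 BE.
have B0 : 0 <= B by rewrite (le_trans ler01).
elim/ltn_ind => k IH kn s t s0 st t0.
have [kN|Nk] := ltnP k N.
  rewrite (le_trans (low _ _ s0 st t0 _ _))//.
  by rewrite ler_peMl ?exprn_ege1// exprn_ge0// powR_ge0.
have k0 : (0 < k)%N by rewrite (leq_trans N0).
have sub x y : a0 <= x -> x <= y -> y <= b0 ->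
    (x \in `[a0, b0]) && (y \in `[a0, b0]).
  move=> x0 xy y0; rewrite !in_itv /= x0 y0 (le_trans xy)//.
  by rewrite (le_trans x0).
have incl : {subset `[s, t] <= `[a0, b0]}.
  move=> x; rewrite !in_itv /= => /andP[sx xt].
  by rewrite (le_trans s0) // (le_trans xt).
have l1 : 0 < 1 - l by rewrite subr_gt0.
pose phi w := B ^+ k.-1 / (1 - l) * (w `^ q^-1) ^+ k.+1.
have c0 : 0 <= B ^+ k.-1 / (1 - l) by rewrite divr_ge0 ?exprn_ge0// ltW.
have phi0 w : 0 <= w -> 0 <= phi w.
  by move=> w0; rewrite mulr_ge0// exprn_ge0// powR_ge0.
have q'0 : 0 <= q^-1 by rewrite invr_ge0 ltW.
have phim w w' : 0 <= w -> w <= w' -> phi w <= phi w'.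
  move=> w0 ww; rewrite ler_wpM2l// lerXn2r ?nnegrE ?powR_ge0//.
  by rewrite ge0_ler_powR ?nnegrE// (le_trans w0).
have phih w : 0 <= w -> phi (w / 2) <= l ^+ N.+1 * phi w.
  move=> w0; rewrite /phi half_rateE// exprMn -/l [leLHS]mulrCA.
  have := phi0 _ w0; rewrite /phi => pw; apply: ler_wpM2r => //.
  by rewrite ler_wiXn2l// ltW.
have := @sewing_bound R (tpow X k.+1) s t v G (fun s t => inc S s t k.+1) phi
  (l ^+ N.+1) st (exprn_ge0 _ h0) hN _ _ phi0 phim phih.
have -> : 2 / (1 - 2 * l ^+ N.+1) * phi (v t - v s) =
   B ^+ k * ((v t - v s) `^ q^-1) ^+ k.+1.
  have -> : B ^+ k = B ^+ k.-1 * B by rewrite -exprSr prednK.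
  by rewrite /phi {3}BE; ring.
apply.
- by move=> x y xI yI; apply: vm; apply: incl.
- by move=> x y xI yI; apply: Gm; apply: incl.
- by move=> x xI; rewrite inc_refl// S0// incl.
- move=> a b c sa ab bc ct.
  have aa0 : a0 <= a := le_trans s0 sa.
  have cb0 : c <= b0 := le_trans ct t0.
  have bb0 : b <= b0 := le_trans bc cb0.
  have ab0 : a0 <= b := le_trans aa0 ab.
  have /andP[aI bI] := sub _ _ aa0 ab bb0.
  have /andP[_ cI] := sub _ _ ab0 bc cb0.
  have := norm_muls_mid k (inc0 (S0 _ aI) (S0 _ bI)) (inc0 (S0 _ bI) (S0 _ cI)).
  rewrite incM ?S0// => /le_trans; apply.
  have vab : 0 <= v b - v a by rewrite subr_ge0 vm.
  have vbc : 0 <= v c - v b by rewrite subr_ge0 vm.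
  set m1 := (v b - v a) `^ q^-1; set m2 := (v c - v b) `^ q^-1.
  apply: (@le_trans _ _
    (\sum_(i < k) B ^+ k.-1 * (m1 ^+ i.+1 * m2 ^+ (k - i)))).
    apply: ler_sum => i _; have ik := ltn_ord i.
    have -> : B ^+ k.-1 * (m1 ^+ i.+1 * m2 ^+ (k - i)) =
       (B ^+ i * m1 ^+ i.+1) * (B ^+ (k - i).-1 * m2 ^+ (k - i)).
      rewrite (_ : k.-1 = i + (k - i).-1)%N ?exprD; first by ring.
      by rewrite -subnS -[in LHS](subnKC ik).
    rewrite ler_pM ?IH// ?(ltn_trans ik)//.
    have ki : (0 < k - i)%N by rewrite subn_gt0.
    case: (k - i)%N ki (leq_subr i k) => // j _ jk.
    by apply: IH => //; apply: ltn_trans kn.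
  rewrite -mulr_sumr /phi -mulrA ler_wpM2l ?exprn_ge0// mulrC.
  have vac : 0 <= v c - v a by rewrite subr_ge0 vm// (le_trans ab).
  apply: mixed_sum; rewrite ?powR_ge0//.
  + by rewrite ge0_ler_powR ?nnegrE// lerB// vm.
  + by rewrite ge0_ler_powR ?nnegrE// lerB// vm.
  + rewrite -half_rateE//; have w0 : 0 <= (v c - v a) / 2 by rewrite divr_ge0.
    have [le1|le2] := leP (v b - v a) ((v c - v a) / 2);
      apply/orP; [left|right]; rewrite ge0_ler_powR ?nnegrE//.
    move: le2; set x := v a; set y := v b; set z := v c; lra.
- move=> e e0; have [|d d0 H] := high k.+1 _ e e0; first by rewrite ltnS Nk.
  exists d => // a b sa ab bt ba; apply: H => //.
    exact: le_trans sa.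
  exact: le_trans t0.
Qed.

End Increments.

(** * Uniform continuity on segments *)

Section UniformContinuity.
Context {R : realType} {W : normedModType R}.

Lemma unif_continuous_segment (f : R -> W) (a b : R) :
  {within `[a, b], continuous f} ->
  forall e, 0 < e -> exists2 d, 0 < d & forall s t, s \in `[a, b] ->
    t \in `[a, b] -> `|s - t| <= d -> `|f s - f t| <= e.
Proof.
move=> /subspace_continuousP fc e e0.
have loc x : x \in `[a, b] -> exists2 r, 0 < r & forall y, y \in `[a, b] ->
    `|x - y| < r -> `|f x - f y| <= e / 2.
  move=> xI; have e2 : 0 < e / 2 by rewrite divr_gt0.
  have /fc/cvgrPdist_le/(_ _ e2) : `[a, b]%classic x by [].
  rewrite /prop_near1 /within /= => /nbhs_ballP[r /= r0 H].
  by exists r => // y yI xy; apply: H => //; rewrite /ball /=.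
have /compact_near_coveringP nc := @segment_compact R a b.
pose P d s := s \in `[a, b] -> forall t, t \in `[a, b] -> `|s - t| <= d ->
  `|f s - f t| <= e.
have /filter_ex : \forall d \near (0 : R)^'+, 0 < d /\ `[a, b]%classic `<=` P d.
  apply: filterI; first exact: nbhs_right_gt.
  apply: (nc R (0 : R)^'+ P _) => x xI; have [r r0 H] := loc _ xI.
  exists (ball x (r / 2), [set d | d < r / 2]) => /=.
    split; first by apply: nbhsx_ballx; rewrite divr_gt0.
    by apply: nbhs_right_lt; rewrite divr_gt0.
  move=> [y d] /= [xy dr] yI t tI yt.
  rewrite -(subrK (f x) (f y)) -addrA (le_trans (ler_normD _ _))//.
  rewrite [e]splitr lerD//.
    rewrite distrC H//; move: xy; rewrite /ball /= => /lt_trans; apply.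
    by move: r0; lra.
  apply: H => //; rewrite -(subrK y x) -addrA (le_lt_trans (ler_normD _ _))//.
  by rewrite [r]splitr ltrD// (le_lt_trans yt).
by move=> [d [d0 Pd]]; exists d => // s t sI; apply: Pd.
Qed.
End UniformContinuity.

(** * Homogeneous norms and controls *)

Section HomogeneousNorm.
Context {R : realType} {V : completeNormedModType R} (X : tensorPowers V).
Implicit Types (a b : tseries X) (S x : R -> tseries X) (n k : nat) (p r : R).

Lemma powR_invK r k : (0 < k)%N -> 0 <= r -> (r `^ k%:R^-1) ^+ k = r.
Proof.
move=> k0 r0; rewrite -powR_mulrn ?powR_ge0// -powRrM mulVf ?powRr1//.
by rewrite pnatr_eq0 -lt0n.
Qed.

Lemma powR_inv_le r e k : (0 < k)%N -> 0 <= e -> 0 <= r ->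
  (r `^ k%:R^-1 <= e) = (r <= e ^+ k).
Proof.
move=> k0 e0 r0; rewrite -[in RHS](powR_invK k0 r0).
by rewrite ler_pXn2r// nnegrE ?powR_ge0.
Qed.

Lemma normT_ge0 n a : 0 <= normT n a.
Proof. by rewrite /normT; exact: bigmax_ge_id. Qed.

Lemma norm_le_normT n a k : (0 < k <= n)%N -> `|a k| <= normT n a ^+ k.
Proof.
move=> /andP[k0 kn]; rewrite -powR_inv_le ?normT_ge0//.
rewrite /normT (le_bigmax_seq 0 k xpredT (fun k => `|a k| `^ k%:R^-1))//.
by rewrite mem_index_iota k0 ltnS.
Qed.

Lemma normT_le n a r : 0 <= r ->
  (forall k, (0 < k <= n)%N -> `|a k| <= r ^+ k) -> normT n a <= r.
Proof.
move=> r0 ar; rewrite /normT big_nat_cond; apply: bigmax_le => // k.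
by rewrite andbT ltnS => kn; rewrite powR_inv_le ?ar//; case/andP: kn.
Qed.

Lemma eq_normT n a b : (forall k, (k <= n)%N -> a k = b k) ->
  normT n a = normT n b.
Proof.
by move=> ab; apply: eq_big_nat => k /andP[_]; rewrite ltnS => kn; rewrite ab.
Qed.

Lemma mulTE n a b k : (k <= n)%N -> mulT n (invT n a) b k = (sinv a * b) k.
Proof.
move=> kn; rewrite /mulT /trunc kn; apply: muls_local => // i ik.
by rewrite /invT /trunc (leq_trans ik kn).
Qed.

Lemma normT_mulT n a b : normT n (mulT n (invT n a) b) = normT n (sinv a * b).
Proof. by apply: eq_normT => k; apply: mulTE. Qed.

Lemma sum_steps_rcons (T : Type) (f : T -> T -> R) (d a t : T) (s : seq T) :
  \sum_(0 <= j < size (rcons s t))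
    f (nth d (a :: rcons s t) j) (nth d (a :: rcons s t) j.+1) =
  \sum_(0 <= j < size s) f (nth d (a :: s) j) (nth d (a :: s) j.+1)
    + f (last a s) t.
Proof.
rewrite size_rcons big_nat_recr//=; congr (_ + f _ _).
- apply: eq_big_nat => j /andP[_ js]; rewrite -rcons_cons !nth_rcons/= js ltnS.
  by rewrite (ltnW js).
- by rewrite -rcons_cons nth_rcons /= ltnSn -last_nth.
- by rewrite nth_rcons ltnn eqxx.
Qed.

(** The supremum [v t] of the costs of the partitions of [[0, t]] works: a
    partition of [[0, s]] is continued to one of [[0, t]] by appending [t], at
    the cost of one increment. *)
Lemma pvar_control n p (T C : R) x : 0 < p -> 0 <= T ->
  {in `[0, T], forall t, x t 0%N = sone X 0%N} ->
  (pvar n p T x <= C%:E)%E ->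
  exists v : R -> R, [/\
    {in `[0, T] &, {homo v : s t / s <= t}},
    {in `[0, T] &, forall s t, v t - v s <= C `^ p} &
    forall s t, 0 <= s -> s <= t -> t <= T ->
      normT n (inc x s t) `^ p <= v t - v s].
Proof.
move=> p0 T0 x0 xC.
pose h s t := normT n (inc x s t) `^ p.
have h0 s t : 0 <= h s t by exact: powR_ge0.
pose cost (s : seq R) :=
  \sum_(0 <= j < size s) h (nth T (0 :: s) j) (nth T (0 :: s) j.+1).
have cost0 s : 0 <= cost s by apply: sumr_ge0 => j _.
have cost_rcons s t : cost (rcons s t) = cost s + h (last 0 s) t.
  exact: sum_steps_rcons.
have costT s : itv_partition 0 T s -> cost s <= C `^ p.
  move=> sT; have : (((cost s) `^ p^-1)%:E <= C%:E)%E.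
    have -> : cost s = \sum_(0 <= j < size s) normT n (mulT n
        (invT n (x (nth T (0 :: s) j))) (x (nth T (0 :: s) j.+1))) `^ p.
      by apply: eq_bigr => j _; rewrite /h normT_mulT.
    apply: le_trans xC; apply: ereal_sup_ubound.
    by exists s; [exact: sT|reflexivity].
  rewrite lee_fin => cC; have c0 : 0 <= cost s `^ p^-1 by exact: powR_ge0.
  rewrite -[leLHS](_ : (cost s `^ p^-1) `^ p = cost s).
    have C0 : 0 <= C := le_trans c0 cC.
    by apply: (ge0_ler_powR (ltW p0)); rewrite ?nnegrE.
  by rewrite -powRrM mulVf ?gt_eqF// powRr1.
have part_rcons (s : seq R) (t u : R) : itv_partition 0 t s -> t < u ->
    itv_partition 0 u (rcons s u).
  move=> [sp /eqP sl] tu; split; last by rewrite last_rcons.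
  by rewrite rcons_path sp sl.
have costt s t : t <= T -> itv_partition 0 t s -> cost s <= C `^ p.
  rewrite le_eqVlt => /orP[/eqP ->|tT st]; first exact: costT.
  apply: le_trans _ (costT _ (part_rcons _ _ _ st tT)).
  by rewrite cost_rcons lerDl.
have part (t : R) : 0 <= t -> exists s, itv_partition 0 t s.
  rewrite le_eqVlt => /orP[/eqP <-|t0]; first by exists [::]; split.
  by exists [:: t]; apply: itv_partition1.
pose E t := [set cost s | s in itv_partition 0 t].
pose v t := sup (E t).
have E0 t : 0 <= t -> E t !=set0 by move=> /part[s ps]; exists (cost s), s.
have EC t : t <= T -> ubound (E t) (C `^ p).
  by move=> tT _ [s ps <-]; apply: costt ps.
have step s t : 0 <= s -> s <= t -> t <= T -> h s t <= v t - v s.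
  move=> s0; rewrite le_eqVlt => /orP[/eqP <-|st] tT.
    rewrite subrr /h inc_refl ?x0 ?in_itv/= ?s0//.
    rewrite (_ : normT n 1 = 0) ?powR0 ?gt_eqF//.
    apply/eqP; rewrite eq_le normT_ge0 andbT.
    apply: normT_le => // k /andP[k0 _].
    by case: k k0 => // k _; rewrite oneS normr0 exprn_ge0.
  rewrite lerBrDl -lerBrDr; apply: ge_sup; first exact: E0.
  move=> _ [l ls <-]; rewrite lerBrDr.
  have -> : cost l + h s t = cost (rcons l t).
    by rewrite cost_rcons; case: ls => _ /eqP ->.
  apply: ub_le_sup; first by exists (C `^ p); apply: EC.
  by exists (rcons l t) => //; apply: part_rcons ls st.
exists v; split => //.
- move=> s t; rewrite !in_itv /= => /andP[s0 _] /andP[_ tT] st.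
  by rewrite -subr_ge0 (le_trans (h0 s t))// step.
- move=> s t; rewrite !in_itv /= => /andP[s0 sT] /andP[t0 tT].
  have vs : 0 <= v s.
    have [l ls] := part _ s0; apply: le_trans (cost0 l) _.
    by apply: ub_le_sup; [exists (C `^ p); apply: EC|exists l].
  rewrite (@le_trans _ _ (v t))// ?gerBl//.
  by apply: ge_sup; [exact: E0|exact: EC].
Qed.

End HomogeneousNorm.

(** * Lifts of rough paths *)

Section Lifts.
Context {R : realType} {V : completeNormedModType R} (X : tensorPowers V).
Implicit Types (a b : tseries X) (S x : R -> tseries X) (n k N : nat).
Implicit Types (p q r e T : R).

Lemma level_delta n (P : nat -> R -> Prop) :
  (forall k d d', d' <= d -> P k d -> P k d') ->
  (forall k, (k <= n)%N -> exists2 d, 0 < d & P k d) ->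
  exists2 d, 0 < d & forall k, (k <= n)%N -> P k d.
Proof.
move=> Pm; elim: n => [|n IH] H.
  have [d d0 Pd] := H 0%N (leqnn 0).
  by exists d => // k; rewrite leqn0 => /eqP ->.
have [k kn|d d0 Pd] := IH; first by apply: H; exact: leqW.
have [d' d'0 Pd'] := H n.+1 (leqnn _).
exists (Num.min d d'); first by rewrite lt_min d0.
move=> k; rewrite leq_eqVlt => /orP[/eqP ->|kn].
  by apply: Pm Pd'; rewrite ge_min lexx orbT.
by apply: (Pm _ d); [rewrite ge_min lexx|exact: Pd].
Qed.

Lemma exp_le_1D r i n : 0 <= r -> (i <= n)%N -> r ^+ i <= (1 + r) ^+ n.
Proof.
move=> r0 i_n; apply: (@le_trans _ _ ((1 + r) ^+ i)).
  by rewrite lerXn2r ?nnegrE ?addr_ge0// lerDr.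
by rewrite ler_weXn2l// lerDl.
Qed.

Lemma norm_muls_bound n A e a b : 0 <= A -> 0 <= e ->
  (forall i, (i <= n)%N -> `|a i| <= A) ->
  (forall i, (i <= n)%N -> `|b i| <= e) ->
  forall k, (k <= n)%N -> `|(a * b) k| <= n.+1%:R * A * e.
Proof.
move=> A0 e0 aA be k kn; rewrite (le_trans (norm_muls _ _ _))//.
apply: (@le_trans _ _ (\sum_(i < k.+1) A * e)).
  apply: ler_sum => i _; rewrite ler_pM ?aA ?be//.
    by rewrite (leq_trans (leq_ord i)).
  by rewrite (leq_trans (leq_subr _ _)).
rewrite sumr_const card_ord -mulrA -[leLHS]mulr_natl ler_wpM2r ?mulr_ge0//.
by rewrite ler_nat ltnS.
Qed.

Lemma powR_le_root p h w : 0 < p -> 0 <= h -> h `^ p <= w -> h <= w `^ p^-1.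
Proof.
move=> p0 h0 hw; rewrite -[leLHS](_ : (h `^ p) `^ p^-1 = h).
  apply: ge0_ler_powR => //; rewrite ?invr_ge0 ?nnegrE ?powR_ge0 ?(ltW p0)//.
  by rewrite (le_trans _ hw)// powR_ge0.
by rewrite -powRrM mulfV ?gt_eqF// powRr1.
Qed.

Lemma sinv1 : sinv (1 : tseries X) = 1.
Proof. by symmetry; apply: sinv_unique => //; rewrite mulr1. Qed.

Lemma inc_start S t : S 0 = sone X -> inc S 0 t = S t.
Proof. by move=> S0; rewrite /inc S0 [sinv _]sinv1 mul1r. Qed.

Lemma pvar_fin n p T S : (pvar n p T S < +oo)%E ->
  exists C : R, (pvar n p T S <= C%:E)%E.
Proof.
case: pvar => [C _|//|_]; first by exists C.
by exists 0; rewrite leNye.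
Qed.

Lemma lift_bounded n p T S : 0 < p -> 0 <= T ->
  {in `[0, T], forall t, S t 0%N = sone X 0%N} -> S 0 = sone X ->
  (pvar n p T S < +oo)%E ->
  exists2 r, 0 <= r & forall t, t \in `[0, T] -> forall k, (k <= n)%N ->
    `|S t k| <= r ^+ k.
Proof.
move=> p0 T0 Su S0 /pvar_fin[C /(pvar_control p0 T0 Su)[v [vm vC vh]]].
exists ((C `^ p) `^ p^-1); first exact: powR_ge0.
move=> t tI [_|k kn]; first by rewrite Su// norm_sone0.
have /andP[t0 tT] : (0 <= t) && (t <= T) by move: tI; rewrite in_itv.
rewrite -(inc_start t S0) (le_trans (@norm_le_normT _ _ _ n _ _ _))//.
rewrite lerXn2r ?nnegrE ?normT_ge0 ?powR_ge0//.
apply: powR_le_root => //; first exact: normT_ge0.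
apply: le_trans (vh _ _ (lexx 0) t0 tT) _; apply: vC => //.
by rewrite in_itv /= lexx.
Qed.

Lemma lift_fine n p T S : 0 < p -> 0 <= T ->
  {in `[0, T], forall t, S t 0%N = sone X 0%N} -> S 0 = sone X ->
  continuous_path n T S -> (pvar n p T S < +oo)%E ->
  forall e, 0 < e -> exists2 d, 0 < d &
    forall s t, 0 <= s -> s <= t -> t <= T -> t - s <= d -> forall k, (0 < k <= n)%N -> `|inc S s t k| <= e.
Proof.
move=> p0 T0 Su S0 Sc Sv e e0.
have [r r0 Sr] := lift_bounded p0 T0 Su S0 Sv.
pose A := (1 + 2 * r) ^+ n.
have A0 : 0 < A by rewrite exprn_gt0// ltr_pwDl// mulr_ge0.
pose e' := e / (n.+1%:R * A).
have e'0 : 0 < e' by rewrite divr_gt0// mulr_gt0// ltr0n.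
have [|k kn|d d0 Sd] := @level_delta n (fun k d => forall s t, s \in `[0, T] ->
   t \in `[0, T] -> `|s - t| <= d -> `|S s k - S t k| <= e').
- by move=> k d d' dd H s t sI tI st; apply: H => //; apply: le_trans dd.
- exact: unif_continuous_segment (Sc k kn) _ e'0.
exists d => // s t s0 st tT ts [//|k] /andP[_ kn].
have sI : s \in `[0, T] by rewrite in_itv /= s0 (le_trans st).
have tI : t \in `[0, T] by rewrite in_itv /= tT (le_trans s0).
have -> : inc S s t k.+1 = (sinv (S s) * (S t - S s)) k.+1.
  by rewrite mulrBr subsE mulVs ?Su// oneS subr0.
have -> : e = n.+1%:R * A * e'.
  by rewrite mulrC divfK// gt_eqF// mulr_gt0// ltr0n.
apply: (norm_muls_bound (n := n)) => //; rewrite ?(ltW A0) ?(ltW e'0)//.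
  move=> i i_n; apply: le_trans (norm_sinv r0 (Su _ sI) (Sr _ sI) i_n) _.
  by rewrite exp_le_1D// mulr_ge0.
move=> i i_n; rewrite subsE; apply: Sd => //.
by rewrite ger0_norm// subr_ge0.
Qed.

(** In a degree [k > p] an increment of norm [h] contributes [h ^+ k], which is
    [h `^ p] times a power of [h] that continuity makes small. *)
Lemma lift_negligible n N p T S : 0 < p -> p < N.+1%:R -> 0 <= T ->
  {in `[0, T], forall t, S t 0%N = sone X 0%N} -> S 0 = sone X ->
  continuous_path n T S -> (pvar n p T S < +oo)%E ->
  exists2 G : R -> R, {in `[0, T] &, {homo G : s t / s <= t}} &
  forall k, (N < k <= n)%N -> forall e, 0 < e -> exists2 d, 0 < d &
    forall s t, 0 <= s -> s <= t -> t <= T -> t - s <= d ->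
    `|inc S s t k| <= e * (G t - G s).
Proof.
move=> p0 pN T0 Su S0 Sc Sv.
have [C /(pvar_control p0 T0 Su)[G [Gm _ Gh]]] := pvar_fin Sv.
exists G => // k /andP[Nk kn] e e0.
pose f : R := N.+1%:R - p; have f0 : 0 < f by rewrite subr_gt0.
pose e1 := Num.min 1 (e `^ f^-1).
have e10 : 0 < e1 by rewrite lt_min ltr01 powR_gt0.
have e11 : e1 <= 1 by rewrite ge_min lexx.
have e1e : e1 `^ f <= e.
  rewrite -[leRHS](_ : (e `^ f^-1) `^ f = e).
    by apply: ge0_ler_powR; rewrite ?nnegrE ?powR_ge0 ?(ltW f0) ?(ltW e10)//
      ge_min lexx orbT.
  by rewrite -powRrM mulVf ?gt_eqF// powRr1// ltW.
have [d d0 Sd] := lift_fine p0 T0 Su S0 Sc Sv (exprn_gt0 n e10).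
exists d => // s t s0 st tT ts.
set h := normT n (inc S s t).
have h0 : 0 <= h by exact: normT_ge0.
have he : h <= e1.
  apply: normT_le; first exact: ltW.
  move=> j jn; apply: le_trans (Sd _ _ s0 st tT ts _ jn) _.
  by rewrite ler_wiXn2l// ?(ltW e10)//; case/andP: jn.
apply: (@le_trans _ _ (h ^+ k)).
  by apply: norm_le_normT; rewrite (leq_ltn_trans _ Nk).
apply: (@le_trans _ _ (h ^+ N.+1)).
  by rewrite ler_wiXn2l// (le_trans he).
have -> : h ^+ N.+1 = h `^ f * h `^ p.
  rewrite -powRD ?subrK ?powR_mulrn//.
  by apply/implyP; rewrite pnatr_eq0.
apply: ler_pM; rewrite ?powR_ge0//; last exact: Gh.
apply: le_trans e1e.
by apply: ge0_ler_powR; rewrite ?nnegrE ?(ltW f0) ?(ltW e10).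
Qed.

Lemma lift_inc p T n x S : is_lift p T n x S ->
  {in `[0, T], forall t, x t 0%N = sone X 0%N} -> 0 <= T ->
  forall s t, s \in `[0, T] -> t \in `[0, T] ->
  forall k, (k <= Num.truncn p)%N -> inc S s t k = inc x s t k.
Proof.
move=> [_ _ _ _ Sx] xu T0 s t sI tI k kN.
have I0 : (0 : R) \in `[0, T] by rewrite in_itv /= lexx.
have SE u i : u \in `[0, T] -> (i <= k)%N -> S u i = inc x 0 u i.
  move=> uI ik; have iN := leq_trans ik kN.
  have := congr1 (fun a : tseries X => a i) (Sx u uI).
  by rewrite /trunc iN mulTE.
transitivity ((sinv (inc x 0 s) * inc x 0 t) k).
  apply: muls_local => i ik; last exact: SE.
  by apply: sinv_local => j ji; apply: SE => //; apply: leq_trans ik.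
have x0 : sinv (x 0) 0%N = sone X 0%N by rewrite sinv0// xu.
rewrite /inc sinvM ?xu// sinvK ?xu// -mulrA [x 0 * _]mulrA mulsV ?xu//.
by rewrite mul1r.
Qed.

Lemma lift_unital p T n x S : is_lift p T n x S ->
  {in `[0, T], forall t, S t 0%N = sone X 0%N}.
Proof. by move=> [St _ _ _ _] t /St[]. Qed.


(** The degrees up to [p] of a lift are those of the path below it, and the
    higher ones are negligible on fine grids, so that a control of the path
    determines the bound on the lift. *)
Lemma lift_bound p q T n x S (a0 b0 : R) (v : R -> R) :
  1 <= p -> 0 <= T -> 0 < q ->
  q < (Num.truncn p).+1%:R -> is_lift p T n x S ->
  {in `[0, T], forall t, x t 0%N = sone X 0%N} ->
  0 <= a0 -> b0 <= T ->
  {in `[a0, b0] &, {homo v : s t / s <= t}} ->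
  (forall s t, a0 <= s -> s <= t -> t <= b0 ->
     normT (Num.truncn p) (inc x s t) `^ q <= v t - v s) ->
  forall k, (k < n)%N -> forall s t, a0 <= s -> s <= t -> t <= b0 ->
  `|inc S s t k.+1| <=
  lyons_const (Num.truncn p) q ^+ k * ((v t - v s) `^ q^-1) ^+ k.+1.
Proof.
move=> p1 T0 q0 qN SL xu a00 b0T vm vh.
have p0 : 0 < p by rewrite (lt_le_trans ltr01).
have N0 : (0 < Num.truncn p)%N by rewrite truncn_gt0.
have Su := lift_unital SL.
have [_ Sc Sv S0 _] := SL.
have pN : p < (Num.truncn p).+1%:R by rewrite truncnS_gt.
have [G Gm Gn] := lift_negligible p0 pN T0 Su S0 Sc Sv.
have incl : {subset `[a0, b0] <= `[0, T]}.
  move=> u; rewrite !in_itv /= => /andP[u0 u1].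
  by rewrite (le_trans a00)// (le_trans u1).
apply: (lyons_bound (G := G)) => //.
- by move=> t /incl; exact: Su.
- by move=> s t /incl sI /incl tI; apply: Gm.
- move=> s t s0 st tb j jN.
  have sI : s \in `[0, T].
    by apply: incl; rewrite in_itv /= s0 (le_trans st).
  have tI : t \in `[0, T].
    by apply: incl; rewrite in_itv /= tb (le_trans s0).
  rewrite (lift_inc SL)//; last by case/andP: jN.
  apply: le_trans (norm_le_normT _ jN) _.
  rewrite lerXn2r ?nnegrE ?normT_ge0 ?powR_ge0// powR_le_root ?normT_ge0//.
  exact: vh.
- move=> k kn e e0; have [d d0 H] := Gn k kn e e0; exists d => // s t s0 st tb.
  by apply: H => //; [exact: le_trans s0|exact: le_trans b0T].
Qed.

End Lifts.

(** * Bounds on short intervals *)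

Section Cells.
Context {R : realType} {V : completeNormedModType R} (X : tensorPowers V).
Implicit Types (a b : tseries X) (S x : R -> tseries X) (n k N : nat).
Implicit Types (p q r e T : R).
Implicit Types (v : R -> R).

Definition control p T W x v : Prop := [/\
  {in `[0, T] &, {homo v : s t / s <= t}},
  {in `[0, T] &, forall s t, v t - v s <= W} &
  forall s t, 0 <= s -> s <= t -> t <= T ->
    normT (Num.truncn p) (inc x s t) `^ p <= v t - v s].

Definition small_steps p T eta d x : Prop :=
  forall s t, 0 <= s -> s <= t -> t <= T -> t - s <= d ->
    normT (Num.truncn p) (inc x s t) <= eta.

(** The radius of growth given by [lift_bound] for the control
    [eta `^ (q - p) * v], when [v] increases by [w]. *)
Definition cell_rate p q eta w : R :=
  lyons_const (Num.truncn p) q * (eta `^ (q - p) * w) `^ q^-1.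

Lemma cell_rate_ge0 p q eta w : 0 < q -> q < (Num.truncn p).+1%:R ->
  0 <= cell_rate p q eta w.
Proof.
move=> q0 qN; rewrite mulr_ge0 ?powR_ge0//.
by rewrite (le_trans _ (lyons_const_ge1 q0 qN)).
Qed.

Lemma cell_rate_le p q eta w w' : 0 < q -> q < (Num.truncn p).+1%:R ->
  0 <= w -> w <= w' -> cell_rate p q eta w <= cell_rate p q eta w'.
Proof.
move=> q0 qN w0 ww; rewrite ler_wpM2l//.
  by rewrite (le_trans _ (lyons_const_ge1 q0 qN)).
apply: ge0_ler_powR; rewrite ?invr_ge0 ?(ltW q0) ?nnegrE ?mulr_ge0 ?powR_ge0//.
  exact: le_trans ww.
by rewrite ler_wpM2l ?powR_ge0.
Qed.

Lemma cell_rate_powR p q eta w : 0 < q -> q < (Num.truncn p).+1%:R -> 0 <= w ->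
  cell_rate p q eta w `^ q =
  lyons_const (Num.truncn p) q `^ q * eta `^ (q - p) * w.
Proof.
move=> q0 qN w0; have b1 := lyons_const_ge1 q0 qN.
have z0 : 0 <= eta `^ (q - p) * w by rewrite mulr_ge0 ?powR_ge0.
rewrite /cell_rate powRM ?powR_ge0//; last by rewrite (le_trans _ b1).
by rewrite -powRrM mulVf ?gt_eqF// powRr1// mulrA.
Qed.

Lemma cell_rate_small p q w e : 0 < q -> q < (Num.truncn p).+1%:R -> p < q ->
  0 <= w -> 0 < e ->
  exists2 eta, 0 < eta <= 1 & cell_rate p q eta w <= e.
Proof.
move=> q0 qN pq w0 e0; have b1 := lyons_const_ge1 q0 qN.
set B := lyons_const _ _ in b1; have B0 : 0 < B by rewrite (lt_le_trans _ b1).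
pose c := (e / B) `^ q / (w + 1).
have w1 : 0 < w + 1 by rewrite ltr_wpDl.
have c0 : 0 < c by rewrite divr_gt0// powR_gt0// divr_gt0.
have f0 : 0 < q - p by rewrite subr_gt0.
pose eta := Num.min 1 (c `^ (q - p)^-1).
have eta0 : 0 < eta by rewrite lt_min ltr01 powR_gt0.
exists eta; first by rewrite eta0 ge_min lexx.
have etac : eta `^ (q - p) <= c.
  rewrite -[leRHS](_ : (c `^ (q - p)^-1) `^ (q - p) = c).
    by apply: ge0_ler_powR; rewrite ?nnegrE ?powR_ge0 ?(ltW f0) ?(ltW eta0)//
      ge_min lexx orbT.
  by rewrite -powRrM mulVf ?gt_eqF// powRr1// ltW.
rewrite /cell_rate -/B mulrC -ler_pdivlMr//.
have eB0 : 0 <= e / B by rewrite divr_ge0 ?ltW.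
rewrite -[leRHS](_ : ((e / B) `^ q) `^ q^-1 = e / B); last first.
  by rewrite -powRrM mulfV ?gt_eqF// powRr1.
apply: ge0_ler_powR; rewrite ?invr_ge0 ?(ltW q0) ?nnegrE ?mulr_ge0 ?powR_ge0//.
apply: (@le_trans _ _ (c * w)); first by rewrite ler_wpM2r.
have eB1 : 0 < (e / B) `^ q by rewrite powR_gt0// divr_gt0.
by rewrite /c -mulrA ger_pMr// mulrC ler_pdivrMr// mul1r lerDl.
Qed.

Lemma control_ge0 p T W x v s t : control p T W x v ->
  0 <= s -> s <= t -> t <= T -> 0 <= v t - v s.
Proof.
move=> [_ _ vh] s0 st tT.
by rewrite (le_trans _ (vh _ _ s0 st tT))// powR_ge0.
Qed.

Lemma control_le p T W x v s t : control p T W x v ->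
  0 <= s -> s <= t -> t <= T -> v t - v s <= W.
Proof.
move=> [_ vW _] s0 st tT; apply: vW; rewrite in_itv /=.
  by rewrite s0 (le_trans st).
by rewrite tT (le_trans s0).
Qed.

Section OneLift.
Context (p T : R) (n : nat) (W : R) (x S : R -> tseries X) (v : R -> R).
Context (p1 : 1 <= p) (T0 : 0 <= T) (xS : is_lift p T n x S).
Context (xu : {in `[0, T], forall t, x t 0%N = sone X 0%N}).
Context (xv : control p T W x v).

Let p0 : 0 < p := lt_le_trans ltr01 p1.
Let pN : p < (Num.truncn p).+1%:R.
Proof. by rewrite truncnS_gt. Qed.

Lemma lift_inc0 s t : 0 <= s -> s <= t -> t <= T -> inc S s t 0%N = sone X 0%N.
Proof.
move=> s0 st tT; apply: inc0; apply: (lift_unital xS); rewrite in_itv /=.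
  by rewrite s0 (le_trans st).
by rewrite tT (le_trans s0).
Qed.

Lemma lift_growth k s t : (k <= n)%N -> 0 <= s -> s <= t -> t <= T ->
  `|inc S s t k| <= (lyons_const (Num.truncn p) p * W `^ p^-1) ^+ k.
Proof.
case: k => [|k] kn s0 st tT; first by rewrite lift_inc0// norm_sone0.
have [vm _ vh] := xv.
have := lift_bound p1 T0 p0 pN xS xu (lexx 0) (lexx T) vm vh kn s0 st tT.
move=> /le_trans; apply; have b1 := lyons_const_ge1 p0 pN.
rewrite [leRHS]exprMn.
rewrite ler_pM ?exprn_ge0 ?powR_ge0 ?ler_weXn2l// ?(le_trans _ b1)//.
rewrite lerXn2r ?nnegrE ?powR_ge0//; apply: ge0_ler_powR.
- by rewrite invr_ge0 ltW.
- by rewrite nnegrE (control_ge0 xv).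
- by rewrite nnegrE (le_trans (control_ge0 xv s0 st tT))// (control_le xv).
- exact: (control_le xv).
Qed.

(** Trading [p] for [q]: where increments have norm [h <= eta], one has
    [h `^ q <= eta `^ (q - p) * h `^ p], and the control gains a small
    factor. *)
Lemma cell_bound q eta d k s t : p < q -> q < (Num.truncn p).+1%:R ->
  0 <= eta -> small_steps p T eta d x ->
  (k <= n)%N -> 0 <= s -> s <= t -> t <= T -> t - s <= d ->
  `|inc S s t k| <= cell_rate p q eta (v t - v s) ^+ k.
Proof.
move=> pq qN eta0 xd; case: k => [|k] kn s0 st tT ts.
  by rewrite lift_inc0// norm_sone0.
have q0 : 0 < q := lt_trans p0 pq.
have [vm _ vh] := xv.
pose v' u := eta `^ (q - p) * v u.
have v'E u w : v' w - v' u = eta `^ (q - p) * (v w - v u) by rewrite /v' mulrBr.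
have incl : {subset `[s, t] <= `[0, T]}.
  move=> u; rewrite !in_itv /= => /andP[u0 u1].
  by rewrite (le_trans s0)// (le_trans u1).
have := @lift_bound _ _ X p q T n x S s t v' p1 T0 q0 qN xS xu s0 tT.
move=> /(_ _ _ k kn s t (lexx s) st (lexx t)) H.
apply: le_trans (H _ _) _.
- by move=> u w /incl uI /incl wI uw; rewrite ler_wpM2l ?powR_ge0// vm.
- move=> u w su uw wt; rewrite v'E.
  set h := normT _ _; have h0 : 0 <= h by exact: normT_ge0.
  have u0 := le_trans s0 su; have wT := le_trans wt tT.
  have he : h <= eta by apply: xd => //; rewrite (le_trans _ ts)// lerB.
  have -> : h `^ q = h `^ (q - p) * h `^ p.
    rewrite -powRD ?subrK//; apply/implyP => /eqP E.
    by move: q0; rewrite -E ltxx.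
  rewrite ler_pM ?powR_ge0 ?vh//.
  by apply: ge0_ler_powR; rewrite ?nnegrE// subr_ge0 ltW.
rewrite v'E /cell_rate [leRHS]exprMn ler_wpM2r ?exprn_ge0 ?powR_ge0//.
by rewrite ler_weXn2l// lyons_const_ge1.
Qed.

End OneLift.
End Cells.

(** * Products over a grid *)

Section Grids.
Context {R : realType} {V : completeNormedModType R} (X : tensorPowers V).
Implicit Types (a b : tseries X) (S Y x : R -> tseries X) (k : nat).

(** The quotient of two products over a grid is built from inside out, one cell
    at a time: each cell multiplies it on the left by an inverse, of radius
    [2 * r], and on the right by a factor of radius [r].  Either costs a
    factor 2 and keeps the radius [4 * r]. *)
Lemma norm_ratio_grid (S Y : R -> tseries X) (tau : nat -> R) (M K : nat)
    (r : R) :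
  0 <= r -> (forall i, S (tau i) 0%N = sone X 0%N) ->
  (forall i, Y (tau i) 0%N = sone X 0%N) ->
  S (tau 0%N) = 1 -> Y (tau 0%N) = 1 ->
  (forall i k, (i < M)%N -> (k <= K)%N ->
     `|inc S (tau i) (tau i.+1) k| <= r ^+ k) ->
  (forall i k, (i < M)%N -> (k <= K)%N ->
     `|inc Y (tau i) (tau i.+1) k| <= r ^+ k) ->
  forall k, (k <= K)%N ->
    `|(sinv (S (tau M)) * Y (tau M)) k| <= 4 ^+ M * (4 * r) ^+ k.
Proof.
move=> r0 Su Yu S0 Y0 Sr Yr.
have r2 : 0 <= 2 * r by rewrite mulr_ge0.
have E4 : 4 * r = 2 * (2 * r) by ring.
elim: M Sr Yr => [|M IH] Sr Yr k kK.
  rewrite S0 Y0 sinv1 mulr1 expr0 mul1r.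
  case: k kK => [|k] kK; first by rewrite norm_sone0.
  by rewrite oneS normr0 exprn_ge0// mulr_ge0.
have SE : S (tau M.+1) = S (tau M) * inc S (tau M) (tau M.+1).
  by rewrite /inc mulrA mulsV// mul1r.
have YE : Y (tau M.+1) = Y (tau M) * inc Y (tau M) (tau M.+1).
  by rewrite /inc mulrA mulsV// mul1r.
rewrite SE YE sinvM//; last by apply: inc0.
rewrite -mulrA [sinv (S _) * _]mulrA mulrA E4.
have -> : 4 ^+ M.+1 = 2 * (2 * 4 ^+ M) :> R by rewrite exprS; ring.
apply: (norm_muls_r (n := K)) => // => [i iK|i iK].
- apply: (norm_muls_l (n := K)) => // => [j jK|j jK].
  + by apply: (norm_sinv r0 (inc0 (Su _) (Su _)) _ jK) => l lK; apply: Sr.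
  + rewrite -E4; apply: IH => // l m lM; [apply: Sr|apply: Yr]; exact: ltnW.
- apply: le_trans (Yr _ _ (ltnSn M) iK) _.
  by rewrite lerXn2r ?nnegrE// -[leLHS]mul1r ler_wpM2r// ler1n.
Qed.

(** The products that follow [S] up to a grid point, and [Y] from there on,
    interpolate between both ends; two neighbours differ in one cell only. *)
Lemma norm_diff_grid (S Y : R -> tseries X) (tau : nat -> R) (M K : nat) (A : R)
    (e : nat -> R) :
  0 <= A -> (forall i, 0 <= e i) -> (forall i, S (tau i) 0%N = sone X 0%N) ->
  (forall i, Y (tau i) 0%N = sone X 0%N) ->
  S (tau 0%N) = 1 -> Y (tau 0%N) = 1 ->
  (forall i k, (i <= M)%N -> (k <= K)%N -> `|S (tau i) k| <= A) ->
  (forall i k, (i <= M)%N -> (k <= K)%N -> `|inc Y (tau i) (tau M) k| <= A) ->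
  (forall i k, (i < M)%N -> (k <= K)%N ->
     `|inc S (tau i) (tau i.+1) k - inc Y (tau i) (tau i.+1) k| <= e i) ->
  forall k, (k <= K)%N ->
    `|S (tau M) k - Y (tau M) k| <=
    \sum_(0 <= i < M) K.+1%:R * (K.+1%:R * A * e i) * A.
Proof.
move=> A0 e0 Su Yu S0 Y0 SA YA SY k kK.
pose F i := S (tau i) * inc Y (tau i) (tau M).
have -> : S (tau M) k - Y (tau M) k = (\sum_(0 <= i < M) (F i.+1 - F i)) k.
  rewrite telescope_sumr// /F inc_refl// mulr1 S0 mul1r /inc Y0.
  by rewrite [sinv _]sinv1 mul1r.
rewrite sums_at (le_trans (ler_norm_sum _ _ _))//.
rewrite ler_sum_nat// => i /andP[_ iM].
have -> : F i.+1 - F i = S (tau i) *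
    (inc S (tau i) (tau i.+1) - inc Y (tau i) (tau i.+1)) *
    inc Y (tau i.+1) (tau M).
  rewrite mulrBr mulrBl /F -[S (tau i) * inc Y _ _ * _]mulrA incM//.
  by rewrite /inc !mulrA mulsV// mul1r.
apply: (norm_muls_bound (n := K)) => //.
- by rewrite !mulr_ge0.
- move=> j jK; apply: (norm_muls_bound (n := K)) => //.
  + by move=> l lK; apply: SA => //; exact: ltnW.
  + by move=> l lK; rewrite subsE; apply: SY.
- by move=> j jK; apply: YA.
Qed.
End Grids.

(** * Comparison of two lifts *)

Section TwoLifts.
Context {R : realType} {V : completeNormedModType R} (X : tensorPowers V).
Context (p q T W eta : R) (K M : nat) (x y S Y : R -> tseries X) (v w : R -> R).
Context (p1 : 1 <= p) (T0 : 0 <= T) (W0 : 0 <= W) (pq : p < q)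
  (qN : q < (Num.truncn p).+1%:R) (eta0 : 0 <= eta) (M0 : (0 < M)%N).
Context (xS : is_lift p T K x S) (yY : is_lift p T K y Y).
Context (xu : {in `[0, T], forall t, x t 0%N = sone X 0%N})
  (yu : {in `[0, T], forall t, y t 0%N = sone X 0%N}).
Context (xv : control p T W x v) (yw : control p T W y w).
Context (xd : small_steps p T eta (T / M%:R) x)
  (yd : small_steps p T eta (T / M%:R) y).

(* The grid of mesh T / M stays at T beyond i = M, so that all its points lie
   in the interval. *)
Let tau (i : nat) : R := (minn i M)%:R / M%:R * T.

Let MR : 0 < M%:R :> R. Proof. by rewrite ltr0n. Qed.

Let tau0 : tau 0%N = 0. Proof. by rewrite /tau min0n !mul0r. Qed.

Let tauM : tau M = T. Proof. by rewrite /tau minnn divff ?mul1r// gt_eqF. Qed.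

Let tau_le i j : (i <= j)%N -> tau i <= tau j.
Proof.
move=> ij; rewrite ler_wpM2r// ler_wpM2r ?invr_ge0 ?ler0n// ler_nat.
by rewrite leq_min geq_minr andbT (leq_trans (geq_minl _ _)).
Qed.

Let tau_ge0 i : 0 <= tau i. Proof. by rewrite -tau0 tau_le. Qed.

Let tau_leT i : tau i <= T.
Proof.
rewrite /tau -[leRHS]mul1r ler_wpM2r// ler_pdivrMr// mul1r ler_nat.
exact: geq_minr.
Qed.

Let tau_step i : tau i.+1 - tau i <= T / M%:R.
Proof.
rewrite /tau -mulrBl -mulrBl mulrAC ler_wpM2r ?invr_ge0 ?ler0n//.
rewrite -[leRHS]mul1r ler_wpM2r// lerBlDr nat1r ler_nat.
by rewrite -minnSS leq_min geq_minl /= (leq_trans (geq_minr _ _)).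
Qed.

Let tauI i : tau i \in `[0, T].
Proof. by rewrite in_itv /= tau_ge0 tau_leT. Qed.

Let Su i : S (tau i) 0%N = sone X 0%N.
Proof. exact: (lift_unital xS). Qed.

Let Yu i : Y (tau i) 0%N = sone X 0%N.
Proof. exact: (lift_unital yY). Qed.

Let S0 : S (tau 0) = 1. Proof. by rewrite tau0; case: xS. Qed.

Let Y0 : Y (tau 0) = 1. Proof. by rewrite tau0; case: yY. Qed.

Let q0 : 0 < q. Proof. by rewrite (lt_trans _ pq)// (lt_le_trans ltr01). Qed.

Let rho := cell_rate p q eta W.

Let cell_S k i : (k <= K)%N ->
  `|inc S (tau i) (tau i.+1) k| <=
  cell_rate p q eta (v (tau i.+1) - v (tau i)) ^+ k.
Proof.
move=> kK; apply: (cell_bound p1 T0 xS xu xv pq qN eta0 xd) => //.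
exact: tau_le.
Qed.

Let cell_Y k i : (k <= K)%N ->
  `|inc Y (tau i) (tau i.+1) k| <=
  cell_rate p q eta (w (tau i.+1) - w (tau i)) ^+ k.
Proof.
move=> kK; apply: (cell_bound p1 T0 yY yu yw pq qN eta0 yd) => //.
exact: tau_le.
Qed.

Let rate_v i : cell_rate p q eta (v (tau i.+1) - v (tau i)) <= rho.
Proof.
apply: cell_rate_le => //; last by apply: (control_le xv); rewrite ?tau_le.
by apply: (control_ge0 xv); rewrite ?tau_le.
Qed.

Let rate_w i : cell_rate p q eta (w (tau i.+1) - w (tau i)) <= rho.
Proof.
apply: cell_rate_le => //; last by apply: (control_le yw); rewrite ?tau_le.
by apply: (control_ge0 yw); rewrite ?tau_le.
Qed.

Lemma lift_ratio_growth k : (k <= K)%N ->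
  `|(sinv (S T) * Y T) k| <= 4 ^+ M * (4 * rho) ^+ k.
Proof.
rewrite -tauM; apply: norm_ratio_grid => //; first exact: cell_rate_ge0.
  move=> i j _ jK; apply: le_trans (cell_S i jK) _.
  by rewrite lerXn2r ?nnegrE ?cell_rate_ge0 ?rate_v.
move=> i j _ jK; apply: le_trans (cell_Y i jK) _.
by rewrite lerXn2r ?nnegrE ?cell_rate_ge0 ?rate_w.
Qed.

Let B := lyons_const (Num.truncn p) p * W `^ p^-1.

(** In the degrees up to [p] each of the [M] cells contributes [e].  In a degree
    above [q], a rate at most 1 may be raised to the power [q] instead, which is
    proportional to the control of the cell; these contributions sum to
    [rho `^ q] for each of the two lifts. *)
Lemma lift_diff_bound e : 0 <= e -> rho <= 1 ->
  (forall s t, 0 <= s -> s <= t -> t <= T -> forall k, (k <= Num.truncn p)%N ->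
     `|inc x s t k - inc y s t k| <= e) ->
  forall k, (k <= K)%N -> `|S T k - Y T k| <=
    K.+1%:R ^+ 2 * ((1 + B) ^+ K) ^+ 2 * (M%:R * e + 2 * rho `^ q).
Proof.
move=> e0 rho1 xy k kK.
have p0 : 0 < p by rewrite (lt_le_trans ltr01).
have pN : p < (Num.truncn p).+1%:R by rewrite truncnS_gt.
have B0 : 0 <= B.
  by rewrite mulr_ge0 ?powR_ge0// (le_trans _ (lyons_const_ge1 p0 pN)).
pose A := (1 + B) ^+ K.
have A0 : 0 <= A by rewrite exprn_ge0// addr_ge0.
pose cst := lyons_const (Num.truncn p) q `^ q * eta `^ (q - p).
have cst0 : 0 <= cst by rewrite mulr_ge0 ?powR_ge0.
have dv i : 0 <= v (tau i.+1) - v (tau i).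
  by apply: (control_ge0 xv); rewrite ?tau_le.
have dw i : 0 <= w (tau i.+1) - w (tau i).
  by apply: (control_ge0 yw); rewrite ?tau_le.
pose E i := e + cst * (v (tau i.+1) - v (tau i))
  + cst * (w (tau i.+1) - w (tau i)).
have E0 i : 0 <= E i.
  by rewrite addr_ge0 ?(mulr_ge0 cst0)// (addr_ge0 e0)// (mulr_ge0 cst0).
have high r j : 0 <= r -> r <= 1 -> (Num.truncn p < j)%N -> r ^+ j <= r `^ q.
  move=> r0 r1 Nj; rewrite -powR_mulrn//.
  have [->|rn0] := eqVneq r 0.
    by rewrite powR0 ?powR_ge0// pnatr_eq0 -lt0n (leq_ltn_trans _ Nj).
  apply: ger_powR; first by rewrite lt_neqAle eq_sym rn0 r0.
  by rewrite (le_trans (ltW qN))// ler_nat.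
have := @norm_diff_grid R V X S Y tau M K A E A0 E0 Su Yu S0 Y0.
rewrite tauM => H; apply: le_trans (H _ _ _ k kK) _ => {H}.
- move=> i j _ jK; have xSS : S 0 = sone X by case: xS.
  rewrite -(inc_start _ xSS) (le_trans (lift_growth p1 T0 xS xu xv jK _ _ _))//.
  exact: exp_le_1D.
- move=> i j _ jK.
  rewrite (le_trans (lift_growth p1 T0 yY yu yw jK _ _ _))//.
  exact: exp_le_1D.
- move=> i j _ jK; have [jN|Nj] := leqP j (Num.truncn p).
    rewrite (lift_inc xS)// (lift_inc yY)//.
    apply: le_trans (xy _ _ _ _ _ _ jN) _ => //; first exact: tau_le.
    by rewrite /E -addrA lerDl addr_ge0 ?(mulr_ge0 cst0).
  rewrite (le_trans (ler_normB _ _))// /E -addrA ler_wpDl// lerD//.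
    rewrite (le_trans (cell_S i jK))// /cst -cell_rate_powR// high//.
      exact: cell_rate_ge0.
    exact: le_trans (rate_v i) rho1.
  rewrite (le_trans (cell_Y i jK))// /cst -cell_rate_powR// high//.
    exact: cell_rate_ge0.
  exact: le_trans (rate_w i) rho1.
have EE i : K.+1%:R * (K.+1%:R * A * E i) * A = K.+1%:R ^+ 2 * A ^+ 2 * E i.
  by clear; clearbody E A; move: (E i) (K.+1%:R : R) => z u; ring.
under eq_bigr => i _ do rewrite EE.
rewrite -/A.
have B1 : 0 <= 1 + B by rewrite addr_ge0.
rewrite -mulr_sumr ler_wpM2l ?mulr_ge0 ?exprn_ge0//.
rewrite /E !big_split /= -!mulr_sumr !telescope_sumr// tau0 tauM.
rewrite sumr_const_nat subn0 -addrA mulr_natl lerD2l.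
rewrite cell_rate_powR// -/cst mulr_natl mulr2n lerD// ler_wpM2l//.
  by apply: (control_le xv).
by apply: (control_le yw).
Qed.

End TwoLifts.

(** * Uniform convergence of increments *)

Section UniformLimits.
Context {R : realType} {V : completeNormedModType R} (X : tensorPowers V).
Implicit Types (x y Y : R -> tseries X) (k N n : nat) (p e T : R).

Lemma cvge0P (u : nat -> \bar R) : (forall n, (0 <= u n)%E) ->
  u @ \oo --> 0%E <->
  forall e, 0 < e -> exists n0, forall n, (n0 <= n)%N -> (u n <= e%:E)%E.
Proof.
move=> u0; split=> [/fine_cvgP[[n1 _ ufin] /cvgrPdist_le ucv] e e0|H].
  have [n2 _ H] := ucv e e0; exists (maxn n1 n2) => n.
  rewrite geq_max => /andP[n1n n2n].
  rewrite -(fineK (ufin n n1n)) lee_fin (le_trans (ler_norm _))//.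
  by rewrite -normrN -[- _]add0r; apply: H.
apply/fine_cvgP; split.
  have [n0 Hn] := H 1 ltr01; exists n0 => // n /= /Hn un.
  by rewrite ge0_fin_numE// (le_lt_trans un)// ltry.
apply/cvgrPdist_le => e e0; have [n0 Hn] := H e e0; exists n0 => // n /= /Hn un.
rewrite sub0r normrN ger0_norm ?fine_ge0// -lee_fin fineK//.
by rewrite ge0_fin_numE// (le_lt_trans un)// ltry.
Qed.

Lemma inc_diff x y s t : x s 0%N = sone X 0%N -> y s 0%N = sone X 0%N ->
  inc x s t - inc y s t =
  sinv (x s) * (x t - y t) + sinv (x s) * (y s - x s) * inc y s t.
Proof.
move=> xs ys; rewrite !mulrBr mulrBl mulVs// mul1r /inc.
by rewrite mulrA -[sinv (x s) * y s * _]mulrA mulsV// mulr1 addrA subrK.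
Qed.

(** By [inc_diff] the difference is linear in [x - y], with coefficients that
    are bounded in terms of [m] alone. *)
Lemma inc_close N T y m : 0 <= m ->
  {in `[0, T], forall t, y t 0%N = sone X 0%N} ->
  (forall t, t \in `[0, T] -> forall k, (k <= N)%N -> `|y t k| <= m) ->
  exists2 C, 0 < C & forall x e, 0 <= e -> e <= 1 ->
    {in `[0, T], forall t, x t 0%N = sone X 0%N} ->
    (forall t, t \in `[0, T] -> forall k, (k <= N)%N ->
       `|x t k - y t k| <= e) ->
    forall s t, s \in `[0, T] -> t \in `[0, T] -> forall k, (k <= N)%N ->
      `|inc x s t k - inc y s t k| <= C * e.
Proof.
move=> m0 yu ym; pose r := m + 1; pose A := (1 + 2 * r) ^+ N.
have r1 : 1 <= r by rewrite lerDr.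
have r0 : 0 <= r by rewrite (le_trans _ r1).
have A0 : 0 < A by rewrite exprn_gt0// ltr_pwDl// mulr_ge0.
pose c : R := N.+1%:R; have c0 : 0 < c by rewrite ltr0n.
have growth z t : t \in `[0, T] -> z t 0%N = sone X 0%N ->
    (forall k, (k <= N)%N -> `|z t k| <= r) ->
    forall k, (k <= N)%N -> `|z t k| <= r ^+ k.
  move=> tI zu zr [_|k kN]; first by rewrite zu norm_sone0.
  by rewrite (le_trans (zr _ kN))// -[leLHS]expr1 ler_weXn2l.
have powA i : (i <= N)%N -> r ^+ i <= A.
  move=> iN; rewrite (le_trans _ (exp_le_1D _ iN)) ?mulr_ge0//.
  by rewrite lerXn2r ?nnegrE ?mulr_ge0// ler_peMl// ler1n.
exists (c * A + c * (c * A) * (c * A * A)).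
  by rewrite addr_gt0 ?mulr_gt0.
move=> x e e0 e1 xu xy s t sI tI k kN.
have xg u : u \in `[0, T] -> forall j, (j <= N)%N -> `|x u j| <= r ^+ j.
  move=> uI; apply: growth => //; first exact: xu.
  move=> j jN; rewrite -(subrK (y u j) (x u j)) (le_trans (ler_normD _ _))//.
  by rewrite addrC lerD ?ym// (le_trans (xy _ uI _ jN)).
have yg u : u \in `[0, T] -> forall j, (j <= N)%N -> `|y u j| <= r ^+ j.
  move=> uI; apply: growth => //; first exact: yu.
  by move=> j jN; rewrite (le_trans (ym _ uI _ jN))// lerDl.
have xiA j : (j <= N)%N -> `|sinv (x s) j| <= A.
  move=> jN; apply: le_trans (norm_sinv r0 (xu _ sI) (xg _ sI) jN) _.
  by rewrite exp_le_1D// mulr_ge0.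
have yiA j : (j <= N)%N -> `|inc y s t j| <= c * A * A.
  move=> jN; apply: (norm_muls_bound (n := N)) => //; rewrite ?(ltW A0)//.
    move=> i iN; apply: le_trans (norm_sinv r0 (yu _ sI) (yg _ sI) iN) _.
    by rewrite exp_le_1D// mulr_ge0.
  by move=> i iN; apply: le_trans (yg _ tI _ iN) (powA _ iN).
rewrite -subsE inc_diff ?xu ?yu// addsE (le_trans (ler_normD _ _))// mulrDl.
rewrite lerD//.
  apply: (norm_muls_bound (n := N)) => //; rewrite ?(ltW A0)//.
  by move=> i iN; rewrite subsE xy.
have -> : c * (c * A) * (c * A * A) * e = c * (c * A * e) * (c * A * A) by ring.
apply: (norm_muls_bound (n := N)) => //;
  rewrite ?mulr_ge0 ?(ltW A0) ?(ltW c0)//.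
move=> j jN; apply: (norm_muls_bound (n := N)) => //; rewrite ?(ltW A0)//.
by move=> i iN; rewrite subsE distrC xy.
Qed.

Lemma lift_base_bounded p T n y Y : 1 <= p -> 0 <= T ->
  is_lift p T n y Y -> (Num.truncn p <= n)%N ->
  {in `[0, T], forall t, y t 0%N = sone X 0%N} ->
  exists2 m, 0 <= m & forall t, t \in `[0, T] ->
    forall k, (k <= Num.truncn p)%N -> `|y t k| <= m.
Proof.
move=> p1 T0 yY Nn yu; have p0 : 0 < p by rewrite (lt_le_trans ltr01).
have [_ _ Yv Y0 _] := yY.
have [r r0 Yr] := lift_bounded p0 T0 (lift_unital yY) Y0 Yv.
have I0 : (0 : R) \in `[0, T] by rewrite in_itv /= lexx.
set N := Num.truncn p in Nn *.
pose a : R := \sum_(i < N.+1) `|y 0 i|.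
have a0 : 0 <= a by rewrite sumr_ge0.
exists (N.+1%:R * a * (1 + r) ^+ N).
  by rewrite !mulr_ge0 ?exprn_ge0 ?addr_ge0.
move=> t tI k kN.
have -> : y t k = (y 0 * Y t) k.
  rewrite -(inc_start t Y0) -[y t](_ : y 0 * inc y 0 t = y t); last first.
    by rewrite /inc mulrA mulsV ?yu// mul1r.
  apply: muls_local => // i ik.
  by rewrite (lift_inc yY)// (leq_trans ik).
apply: (norm_muls_bound (n := N)) => //; first by rewrite exprn_ge0 ?addr_ge0.
  move=> i iN; have iN' : (i < N.+1)%N by [].
  by rewrite /a (bigD1 (Ordinal iN'))//= lerDl sumr_ge0.
move=> i iN; rewrite (le_trans (Yr _ tI i _)) ?exp_le_1D//.
exact: leq_trans Nn.
Qed.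

Lemma unif_dist_level p T x y e : 0 <= e ->
  (unif_dist p T x y <= e%:E)%E ->
  forall t, t \in `[0, T] -> forall k, (0 < k <= Num.truncn p)%N ->
  `|x t k - y t k| <= e ^+ k.
Proof.
move=> e0 xy t tI k kN.
have : normT (Num.truncn p) (ssub (x t) (y t)) <= e.
  by rewrite -lee_fin (le_trans _ xy)//; apply: ereal_sup_ubound; exists t.
move=> /(lerXn2r k) => H.
apply: le_trans (norm_le_normT (ssub (x t) (y t)) kN) _.
by apply: H; rewrite nnegrE// normT_ge0.
Qed.

Lemma unif_dist_ge0 p T x y : 0 <= T -> (0 <= unif_dist p T x y)%E.
Proof.
move=> T0; apply: (@le_trans _ _ (normT (Num.truncn p) (ssub (x 0) (y 0)))%:E).
  by rewrite lee_fin normT_ge0.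
by apply: ereal_sup_ubound; exists 0 => //=; rewrite in_itv /= lexx.
Qed.

Lemma norm_irc_ge0 (a : tseries X) : (0 <= norm_irc a)%E.
Proof.
apply: (@le_trans _ _ (`|a 1%N| `^ (1%:R^-1))%:E).
  by rewrite lee_fin powR_ge0.
by apply: ereal_sup_ubound; exists 1%N.
Qed.

Lemma norm_irc_le (a : tseries X) e : 0 <= e ->
  (forall k, `|a k.+1| <= e ^+ k.+1) -> (norm_irc a <= e%:E)%E.
Proof.
move=> e0 ae; apply: ge_ereal_sup => _ [[//|k] _ <-].
by rewrite lee_fin powR_inv_le.
Qed.

Lemma WGOmega_unital p T x : WGOmega p T x ->
  {in `[0, T], forall t, x t 0%N = sone X 0%N}.
Proof. by move=> [_ xG _] t /xG[[]]. Qed.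

End UniformLimits.

(** * Convergence of signatures *)

Section Convergence.
Context {R : realType} {V : completeNormedModType R} (X : tensorPowers V).
Context (p T : R) (x : nat -> R -> tseries X) (y : R -> tseries X).
Context (p1 : 1 <= p) (T0 : 0 < T).
Context (hx : forall n, WGOmega p T (x n)) (hy : WGOmega p T y).
Context (hunif : (fun n => unif_dist p T (x n) y) @ \oo --> 0%E).
Context (s : nat -> tseries X) (sy : tseries X).
Context (hs : forall n, is_signature p T (x n) (s n))
  (hsy : is_signature p T y sy).

Let N := Num.truncn p.
Let p0 : 0 < p := lt_le_trans ltr01 p1.
Let T0' : 0 <= T := ltW T0.
Let xu n := WGOmega_unital (hx n).
Let yu := WGOmega_unital hy.

Lemma inc_unif e : 0 < e -> exists n0, forall n, (n0 <= n)%N ->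
  forall s t, 0 <= s -> s <= t -> t <= T -> forall k, (k <= N)%N ->
  `|inc (x n) s t k - inc y s t k| <= e.
Proof.
move=> e0; have [_ /(_ N (leqnn _))[Y yY _]] := hsy.
have [m m0 ym] := lift_base_bounded p1 T0' yY (leqnn _) yu.
have [C C0 H] := inc_close m0 yu ym.
pose d := Num.min 1 (e / C).
have d0 : 0 < d by rewrite lt_min ltr01 divr_gt0.
have d1 : d <= 1 by rewrite ge_min lexx.
have [n0 Hn] := (cvge0P (fun n => unif_dist_ge0 p (x n) y T0')).1 hunif d d0.
exists n0 => n /Hn xy u t u0 ut tT k kN.
have uI : u \in `[0, T] by rewrite in_itv /= u0 (le_trans ut).
have tI : t \in `[0, T] by rewrite in_itv /= tT (le_trans u0).
apply: (@le_trans _ _ (C * d)).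
  apply: H => //; rewrite ?(ltW d0)//.
  move=> w wI [_|j jN]; first by rewrite xu// yu// subrr normr0 ltW.
  apply: le_trans (unif_dist_level (ltW d0) xy wI _) _ => //.
  by rewrite exprS ler_piMr ?(ltW d0)// exprn_ile1// ltW.
by rewrite mulrC -ler_pdivlMr// ge_min lexx orbT.
Qed.

(** The grid is the one of [y]: the uniformly small distance to [y] leaves room
    for the increments of [x n]. *)
Lemma uniformly_small_steps eta : 0 < eta -> eta <= 1 ->
  exists2 M, (0 < M)%N & exists n0, forall n, (n0 <= n)%N ->
    small_steps p T eta (T / M%:R) (x n) /\ small_steps p T eta (T / M%:R) y.
Proof.
move=> eta0 eta1; have [_ /(_ N (leqnn _))[Y yY _]] := hsy.
have [_ Yc Yv Y0 _] := yY.
(* As eta / 2 <= 1, this is the least of the powers with exponent at most N. *)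
pose e := (eta / 2) ^+ N.
have h0 : 0 < eta / 2 by rewrite divr_gt0.
have h1 : eta / 2 <= 1 by move: eta0 eta1; lra.
have e0 : 0 < e by rewrite exprn_gt0.
have [d d0 Yd] := lift_fine p0 T0' (lift_unital yY) Y0 Yc Yv e0.
have [n0 Hn] := inc_unif e0.
pose M := (Num.truncn (T / d)).+1.
have M0 : 0 < M%:R :> R by rewrite ltr0n.
have Md : T / M%:R <= d.
  by rewrite ler_pdivrMr// -ler_pdivrMl// mulrC ltW// truncnS_gt.
have ej j : (0 < j <= N)%N -> e + e <= eta ^+ j.
  move=> /andP[j0 jN]; rewrite -(divfK (_ : 2 != 0 :> R) eta)// exprMn -mulr2n.
  rewrite -[leLHS]mulr_natr ler_pM ?(ltW e0)//.
    by rewrite ler_wiXn2l// ltW.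
  by rewrite -[leLHS]expr1 ler_weXn2l// ler1n.
have yd u t j : 0 <= u -> u <= t -> t <= T -> t - u <= T / M%:R ->
    (0 < j <= N)%N -> `|inc y u t j| <= e.
  move=> u0 ut tT tu jN.
  have uI : u \in `[0, T] by rewrite in_itv /= u0 (le_trans ut).
  have tI : t \in `[0, T] by rewrite in_itv /= tT (le_trans u0).
  rewrite -(lift_inc yY)//; last by case/andP: jN.
  by apply: Yd => //; apply: le_trans Md.
exists M => //; exists n0 => n /Hn xy; split=> u t u0 ut tT tu.
  apply: normT_le => [|j jN]; first exact: ltW.
  rewrite -(subrK (inc y u t j) (inc (x n) u t j)) (le_trans (ler_normD _ _))//.
  rewrite (le_trans _ (ej _ jN))// lerD ?yd// xy//; by case/andP: jN.
apply: normT_le => [|j jN]; first exact: ltW.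
by rewrite (le_trans _ (ej _ jN))// ler_wpDl ?yd// ltW.
Qed.

Context (C : R) (xC : forall n, (pvar N p T (x n) <= C%:E)%E)
  (yC : (pvar N p T y <= C%:E)%E).

Let W := C `^ p.
Let W0 : 0 <= W := powR_ge0 _ _.
Let q := (p + N.+1%:R) / 2.
Let pN : p < N.+1%:R.
Proof. by rewrite truncnS_gt. Qed.
Let pq : p < q.
Proof. by rewrite /q; move: pN; lra. Qed.
Let qN : q < N.+1%:R.
Proof. by rewrite /q; move: pN; lra. Qed.
Let q0 : 0 < q := lt_trans p0 pq.

Let xcontrol n : exists v, control p T W (x n) v.
Proof.
by have [v [? ? ?]] := pvar_control p0 T0' (@xu n) (xC n); exists v; split.
Qed.

Let ycontrol : exists v, control p T W y v.
Proof. by have [v [? ? ?]] := pvar_control p0 T0' yu yC; exists v; split. Qed.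

Let ratio_lift n K S Y k : trunc K (s n) = S T -> trunc K sy = Y T ->
  (k <= K)%N -> (sinv (s n) * sy) k = (sinv (S T) * Y T) k.
Proof.
move=> <- <- kK.
apply: muls_local => i ik; last by rewrite /trunc (leq_trans ik).
by apply: sinv_local => j ji; rewrite /trunc (leq_trans ji (leq_trans ik kK)).
Qed.

(** The factor [4 ^+ M] of [lift_ratio_growth] is absorbed by [2 ^+ k] as soon
    as [2 * M <= k]; the level of the lifts must grow with [k], but the number
    of cells does not. *)
Lemma high_degrees e : 0 < e -> exists K n0, forall n, (n0 <= n)%N ->
  forall k, (K <= k)%N -> `|(sinv (s n) * sy) k| <= e ^+ k.
Proof.
move=> e0; have e8 : 0 < e / 8 by rewrite divr_gt0.
have [eta /andP[eta0 eta1] etae] := cell_rate_small q0 qN pq W0 e8.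
have [M M0 [n0 Hn]] := uniformly_small_steps eta0 eta1.
exists (2 * M)%N, n0 => n /Hn[xd yd] k Mk.
pose K := maxn k N.
have [_ /(_ K (leq_maxr _ _))[S xS sS]] := hs n.
have [_ /(_ K (leq_maxr _ _))[Y yY syY]] := hsy.
have [v xv] := xcontrol n; have [w yw] := ycontrol.
rewrite (ratio_lift sS syY (leq_maxl _ _)).
have H := @lift_ratio_growth _ _ X p q T W eta K M _ _ S Y v w p1 T0' pq qN
  (ltW eta0) M0 xS yY (@xu n) yu xv yw xd yd.
apply: le_trans (H k (leq_maxl _ _)) _ => //.
apply: (@le_trans _ _ (2 ^+ k * (e / 2) ^+ k)); last first.
  by rewrite -exprMn mulrC divfK.
apply: ler_pM; rewrite ?exprn_ge0//.
- by rewrite mulr_ge0// cell_rate_ge0.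
- have -> : 4 = 2 ^+ 2 :> R by ring.
  by rewrite -exprM ler_weXn2l// ler1n.
- have r0 := cell_rate_ge0 eta W q0 qN.
  apply: lerXn2r; rewrite ?nnegrE ?(mulr_ge0 _ r0) ?divr_ge0 ?(ltW e0)//.
  by move: etae; set z := cell_rate _ _ _ _; lra.
Qed.

(** Here the level [L] of the lifts is fixed first: the cells are then chosen
    small for the higher degrees, and [n] large for the number of cells. *)
Lemma low_degrees K e : 0 < e -> exists n0, forall n, (n0 <= n)%N ->
  forall k, (k < K)%N -> `|(sinv (s n) * sy) k.+1| <= e.
Proof.
move=> e0; pose L := maxn K N.
pose B := lyons_const N p * W `^ p^-1.
have B0 : 0 <= B.
  by rewrite mulr_ge0 ?powR_ge0// (le_trans _ (lyons_const_ge1 p0 pN)).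
pose A := (1 + B) ^+ L; pose A' := (1 + 2 * B) ^+ L.
have A0 : 0 < A by rewrite exprn_gt0// ltr_pwDl.
have A'0 : 0 < A' by rewrite exprn_gt0// ltr_pwDl// mulr_ge0.
have L0 : 0 < L.+1%:R :> R by rewrite ltr0n.
have LA0 : 0 < L.+1%:R ^+ 2 * A ^+ 2 by rewrite mulr_gt0// exprn_gt0.
(* The constant of lift_diff_bound, times the one that comes from multiplying
   the difference by the inverse of the signature. *)
pose D := L.+1%:R * A' * (L.+1%:R ^+ 2 * A ^+ 2).
have D0 : 0 < D by rewrite (mulr_gt0 (mulr_gt0 L0 A'0)).
pose d := e / D; have d0 : 0 < d by rewrite divr_gt0.
pose rho := Num.min 1 ((d / 4) `^ q^-1).
have rho0 : 0 < rho by rewrite lt_min ltr01 powR_gt0 ?divr_gt0.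
have [eta /andP[eta0 eta1] etar] := cell_rate_small q0 qN pq W0 rho0.
have [M M0 [n1 Hn1]] := uniformly_small_steps eta0 eta1.
have MR : 0 < M%:R :> R by rewrite ltr0n.
have e'0 : 0 < d / 2 / M%:R by rewrite !divr_gt0.
have [n2 Hn2] := inc_unif e'0.
exists (maxn n1 n2) => n; rewrite geq_max => /andP[/Hn1[xd yd] /Hn2 xy] k kK.
have kL : (k.+1 <= L)%N by rewrite (leq_trans kK)// leq_maxl.
have [_ /(_ L (leq_maxr _ _))[S xS sS]] := hs n.
have [_ /(_ L (leq_maxr _ _))[Y yY syY]] := hsy.
have [v xv] := xcontrol n; have [w yw] := ycontrol.
have r1 : cell_rate p q eta W <= 1.
  by rewrite (le_trans etar)// ge_min lexx.
have H := @lift_diff_bound _ _ X p q T W eta L M _ _ S Y v w p1 T0' W0 pq qN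
  (ltW eta0) M0 xS yY (@xu n) yu xv yw xd yd _ (ltW e'0) r1 xy.
rewrite (ratio_lift sS syY kL).
have TI : T \in `[0, T] by rewrite in_itv /= lexx T0'.
have Su : S T 0%N = sone X 0%N by rewrite (lift_unital xS).
have SB i : (i <= L)%N -> `|S T i| <= B ^+ i.
  move=> iL; have S0 : S 0 = sone X by case: xS.
  by rewrite -(inc_start T S0) (lift_growth p1 T0' xS (@xu n) xv).
have -> : (sinv (S T) * Y T) k.+1 = (sinv (S T) * (Y T - S T)) k.+1.
  by rewrite mulrBr subsE mulVs// oneS subr0.
have -> : e = L.+1%:R * A' * (L.+1%:R ^+ 2 * A ^+ 2 * d).
  by rewrite mulrA mulrC divfK// gt_eqF.
apply: (norm_muls_bound (n := L)) => //.
- exact: ltW.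
- by rewrite (mulr_ge0 (ltW LA0) (ltW d0)).
- move=> i iL; apply: le_trans (norm_sinv B0 Su SB iL) _.
  by rewrite exp_le_1D// mulr_ge0.
- move=> i iL; rewrite subsE distrC; apply: le_trans (H i iL) _.
  apply: ler_wpM2l (ltW LA0) _ _ _.
  rewrite [X in X + _]mulrC divfK ?gt_eqF//.
  have : cell_rate p q eta W `^ q <= d / 4.
    rewrite -[leRHS](_ : ((d / 4) `^ q^-1) `^ q = d / 4); last first.
      by rewrite -powRrM mulVf ?gt_eqF// powRr1// divr_ge0// ltW.
    apply: ge0_ler_powR; rewrite ?nnegrE ?powR_ge0 ?cell_rate_ge0 ?(ltW q0)//.
    by rewrite (le_trans etar)// ge_min lexx orbT.
  by set z := _ `^ q; lra.
Qed.

Lemma signature_cvg : (fun n => dist_irc (s n) sy) @ \oo --> 0%E.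
Proof.
apply/cvge0P => [n|e e0]; first exact: norm_irc_ge0.
have [K [n1 H1]] := high_degrees e0.
pose e' := Num.min 1 e ^+ K.
have m0 : 0 < Num.min 1 e by rewrite lt_min ltr01.
have [n2 H2] := low_degrees K (exprn_gt0 K m0).
exists (maxn n1 n2) => n; rewrite geq_max => /andP[/H1 hi /H2 lo].
apply: norm_irc_le => [|k]; first exact: ltW.
have [Kk|kK] := leqP K k.+1; first exact: hi.
apply: le_trans (lo _ (ltnW kK)) _.
apply: (@le_trans _ _ (Num.min 1 e ^+ k.+1)).
  by rewrite ler_wiXn2l ?(ltW m0) ?ge_min ?lexx// ltnW.
by rewrite lerXn2r ?nnegrE ?(ltW m0) ?(ltW e0)// ge_min lexx orbT.
Qed.

End Convergence.

Theorem lemma1p6 (R : realType) (V : completeNormedModType R)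
    (X : tensorPowers V) (p T : R) (hp : 1 <= p) (hT : 0 < T)
    (x : nat -> R -> tseries X) (y : R -> tseries X)
    (hx : forall n, WGOmega p T (x n)) (hy : WGOmega p T y)
    (hbound : (ereal_sup (range (fun n => pvar (Num.truncn p) p T (x n))) < +oo)%E)
    (hunif : (fun n => unif_dist p T (x n) y) @ \oo --> 0%E)
    (s : nat -> tseries X) (sy : tseries X)
    (hs : forall n, is_signature p T (x n) (s n)) (hsy : is_signature p T y sy) :
  exists phi : nat -> nat,
    {homo phi : m n / (m < n)%N >-> (m < n)%N} /\
    (fun k => dist_irc (s (phi k)) sy) @ \oo --> 0%E.
Proof.
exists id; split=> //.
have [C xC] : exists C : R, forall n, (pvar (Num.truncn p) p T (x n) <= C%:E)%E.
  have ub n : (pvar (Num.truncn p) p T (x n) <=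
      ereal_sup (range (fun n => pvar (Num.truncn p) p T (x n))))%E.
    by apply: ereal_sup_ubound; exists n.
  move: (ereal_sup _) hbound ub => [C _ ub|//|_ ub]; first by exists C.
  by exists 0 => n; rewrite (le_trans (ub n))// leNye.
have [C' yC] := pvar_fin (let: And3 _ _ h := hy in h).
pose D := Num.max C C'.
apply: (signature_cvg (C := D) hp hT hx hy hunif hs hsy).
- by move=> n; rewrite (le_trans (xC n))// lee_fin le_max lexx.
- by rewrite (le_trans yC)// lee_fin le_max lexx orbT.
Qed.
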